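(* Let $\sigma$ be a real constant (permitted to be positive or negative) and consider a solitary wave with surface tension coefficient $\sigma$ and with $\sup u<c$, given in height-function form by $(h,H)$, satisfying, for some $0<\alpha<1$ and $r=2/(1-\alpha)$, the regularity $$\eta=h(\cdot,0)-H(0)\in W^{2,r}_{\mathrm{loc}}(\mathbb{R}),\qquad h\in W^{2,r}_{\mathrm{loc}}(\overline\Omega)\subset C^{1+\alpha}_{\mathrm{loc}}(\overline\Omega),\qquad H\in W^{2,r}[-m,0].$$ Let $F>0$ be its Froude number. Then $F\ne1$. Moreover, $F>1$ if it is a wave of elevation, and $F<1$ if it is a wave of depression.
   Context: Fix $g>0$, $d>0$, $c>0$, and a flux $m>0$. Let $\Omega=\{(q,p):-m<p<0\}$. Physically, a solitary wave with surface tension is a solution of the steady incompressible Euler equations $(u-c)u_x+vu_y=-P_x$, $(u-c)v_x+vv_y=-P_y-g$, $u_x+v_y=0$ in $-d<y<\eta(x)$, with $v=0$ on $y=-d$, $v=(u-c)\eta_x$ and $P+\sigma\big(\eta_x/\sqrt{1+\eta_x^2}\big)_x=0$ on $y=\eta(x)$, and $\eta\to0$, $v\to0$, $u\to U(y)$ as $x\to\pm\infty$ uniformly in $y$. When $\sup u<c$, let $\psi$ be the stream function ($\psi_y=u-c$, $\psi_x=-v$, $\psi=0$ on $y=\eta(x)$, $\psi=m$ on $y=-d$, where $m=\int_{-d}^0(c-U(y))\,dy$), and use the variables $q=x$, $p=-\psi$. The height function $h(q,p)$ is defined by $h(x,-\psi(x,y))=y+d$, and the asymptotic height function $H$ by $H(-\Psi(y))=y+d$,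 where $\Psi(y)=\int_0^y(U(s)-c)\,ds$. Thus $H(-m)=0$, $H(0)=d$. In height-function form (the form used here), a solitary wave with $\sup u<c$ is a pair $(h,H)$ with $\inf h_p>0$, $\min H_p>0$, $H(-m)=0$, $H(0)=d$, satisfying $$\Big(-\frac{1+h_q^2}{2h_p^2}+\frac1{2H_p^2}\Big)_p+\Big(\frac{h_q}{h_p}\Big)_q=0\quad\text{in }-m<p<0,$$ $$\frac{1+h_q^2}{2h_p^2}-\frac1{2H_p^2}+g(h-H)-\sigma\Big(\frac{h_q}{(1+h_q^2)^{1/2}}\Big)_q=0\quad\text{on }p=0,$$ $h=0$ on $p=-m$, and $h_p\to H_p$, $h_q\to0$ as $q\to\pm\infty$ uniformly in $p$. The velocity and surface are recovered by $c-u=1/h_p$, $v=-h_q/h_p$, $\eta(q)=h(q,0)-H(0)$, with $c-U(H(p)-d)=1/H_p(p)$. The Froude number $F>0$ is defined by $\displaystyle\frac1{F^2}=g\int_{-d}^0\frac{dy}{(c-U(y))^2}=g\int_{-m}^0H_p^3\,dp$. The wave is a wave of elevation if $\eta(x)\ge0$ for all $x$ but $\eta\not\equiv0$, and a wave of depression if $\eta(x)\le0$ for all $x$ but $\eta\not\equiv0$.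
   Formalization: The claim F≠1 is stated only for nontrivial waves (h not identically equal to H), since the shear flow h=H meets every listed condition and can have F=1, for instance with H linear and g=m²/d³. *)

(* Defs.v *)
From HB Require Import structures.
From mathcomp Require Import all_boot all_order all_algebra.
From mathcomp Require Import all_classical all_reals all_analysis.
Set Implicit Arguments.
Unset Strict Implicit.
Unset Printing Implicit Defensive.
Import Order.TTheory GRing.Theory Num.Theory.
Import numFieldNormedType.Exports.
Local Open Scope classical_set_scope.
Local Open Scope ring_scope.

Section test_functions.
Context {R : realType} {V : normedModType R}.
Implicit Types (f phi : V -> R) (U : set V).

(* C^oo on a finite-dimensional V: all iterated directional derivatives, in
   all directions, exist and are continuous. *)
Definition smooth f : Prop :=
  forall vs : seq V, let df := foldr (fun v k => 'D_v k) f vs in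
    continuous df /\ (forall x v, derivable df x v).

Definition test_function U phi : Prop :=
  let supp := closure [set x | phi x != 0] in
  [/\ smooth phi, compact supp & supp `<=` U].

(* alpha-Hoelder continuity on every compact subset of D. *)
Definition holder_loc (alpha : R) (D : set V) f : Prop :=
  forall K, compact K -> K `<=` D ->
    exists C : R, forall x y, K x -> K y ->
      `|f x - f y| <= C * `|x - y| `^ alpha.

End test_functions.

(* Sobolev spaces over an open set U, local up to the boundary: the L^r bounds
   are over K `&` U for every compact K in the closure of U, so that for bounded
   U these are the ordinary spaces W^{k,r}(U). *)
Section sobolev_line.
Context {R : realType}.
Local Notation mu := (@lebesgue_measure R).
Implicit Types (r : R) (U : set R) (f g : R -> R).

Definition Lr_loc_line r U f : Prop :=
  measurable_fun U f /\
  forall K, compact K -> K `<=` closure U ->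
    (\int[mu]_(x in K `&` U) (`|f x| `^ r)%:E < +oo)%E.

Definition weak_derivative_line U f g : Prop :=
  [/\ locally_integrable U f, locally_integrable U g &
      forall phi : R -> R, test_function U phi ->
        \int[mu]_(x in U) (f x * 'D_1 phi x) =
        - \int[mu]_(x in U) (g x * phi x)].

Fixpoint sobolev_loc_line (k : nat) r U f : Prop :=
  Lr_loc_line r U f /\
  if k is k'.+1 then
    exists2 g, weak_derivative_line U f g & sobolev_loc_line k' r U g
  else True.

End sobolev_line.

Section sobolev_plane.
Context {R : realType}.
Implicit Types (r : R) (U : set (R * R)) (v : R * R) (f g : R * R -> R).

Definition lebesgue_plane := (@lebesgue_measure R \x @lebesgue_measure R)%E.
Local Notation mu := lebesgue_plane.

(* The two-dimensional analogue of [locally_integrable]. *)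
Definition locally_integrable_plane U f : Prop :=
  [/\ measurable_fun U f, open U &
      forall K, K `<=` U -> compact K ->
        (\int[mu]_(x in K) `|f x|%:E < +oo)%E].

Definition Lr_loc_plane r U f : Prop :=
  measurable_fun U f /\
  forall K, compact K -> K `<=` closure U ->
    (\int[mu]_(x in K `&` U) (`|f x| `^ r)%:E < +oo)%E.

Definition weak_derivative_plane U v f g : Prop :=
  [/\ locally_integrable_plane U f, locally_integrable_plane U g &
      forall phi : R * R -> R, test_function U phi ->
        \int[mu]_(x in U) (f x * 'D_v phi x) =
        - \int[mu]_(x in U) (g x * phi x)].

Fixpoint sobolev_loc_plane (k : nat) r U f : Prop :=
  Lr_loc_plane r U f /\
  if k is k'.+1 then
    forall v, exists2 g, weak_derivative_plane U v f g
                       & sobolev_loc_plane k' r U g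
  else True.

End sobolev_plane.

Section solitary_waves.
Context {R : realType}.
Implicit Types (g d m sigma alpha : R) (h hq hp : R * R -> R) (H Hp : R -> R).

Definition strip m : set (R * R) := [set x | - m < x.2 < 0].
Definition closed_strip m : set (R * R) := [set x | - m <= x.2 <= 0].

Definition elevation h H : R -> R := fun q => h (q, 0) - H 0.

(* [hq], [hp] and [Hp] are the derivatives of [h] and [H], extended
   continuously up to the boundary.  The functions are taken to be the C^1
   representatives provided by the Sobolev embedding. *)
Record wave_regularity m alpha h hq hp H Hp : Prop := WaveRegularity {
  surface_sobolev :
    sobolev_loc_line 2 (2 / (1 - alpha)) setT (elevation h H);
  h_sobolev : sobolev_loc_plane 2 (2 / (1 - alpha)) (strip m) h;
  h_continuous : {within closed_strip m, continuous h};
  h_derive : forall x, strip m x ->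
    is_derive x (1, 0) h (hq x) /\ is_derive x (0, 1) h (hp x);
  hq_holder : holder_loc alpha (closed_strip m) hq;
  hp_holder : holder_loc alpha (closed_strip m) hp;
  H_sobolev : sobolev_loc_line 2 (2 / (1 - alpha)) `]- m, 0[ H;
  H_continuous : {within `[- m, 0], continuous H};
  H_derive : forall p, - m < p < 0 -> is_derive p 1 H (Hp p);
  Hp_continuous : {within `[- m, 0], continuous Hp}
}.

(* The derivatives of the fluxes and of the curvature term are weak
   derivatives, and the equations hold almost everywhere. *)
Record solitary_wave g d m sigma h hq hp H Hp : Prop := SolitaryWave {
  inf_hp_gt0 : 0 < inf (hp @` closed_strip m);
  min_Hp_gt0 : 0 < inf (Hp @` `[- m, 0]);
  H_bottom : H (- m) = 0;
  H_top : H 0 = d;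
  interior_equation : exists A B : R * R -> R,
    [/\ weak_derivative_plane (strip m) (0, 1)
          (fun x => - ((1 + hq x ^+ 2) / (2 * hp x ^+ 2))
                    + 1 / (2 * Hp x.2 ^+ 2)) A,
        weak_derivative_plane (strip m) (1, 0) (fun x => hq x / hp x) B &
        {ae lebesgue_plane, forall x, strip m x -> A x + B x = 0}];
  surface_equation : exists S : R -> R,
    weak_derivative_line setT
      (fun q => hq (q, 0) / Num.sqrt (1 + hq (q, 0) ^+ 2)) S /\
    {ae lebesgue_measure, forall q : R,
       (1 + hq (q, 0) ^+ 2) / (2 * hp (q, 0) ^+ 2) - 1 / (2 * Hp 0 ^+ 2)
       + g * (h (q, 0) - H 0) - sigma * S q = 0};
  bottom_condition : forall q, h (q, - m) = 0;
  hp_pinfty : {uniform `[- m, 0], (fun q p => hp (q, p)) @ +oo --> Hp};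
  hp_ninfty : {uniform `[- m, 0], (fun q p => hp (q, p)) @ -oo --> Hp};
  hq_pinfty :
    {uniform `[- m, 0], (fun q p => hq (q, p)) @ +oo --> (fun=> 0 : R)};
  hq_ninfty :
    {uniform `[- m, 0], (fun q p => hq (q, p)) @ -oo --> (fun=> 0 : R)}
}.

(* The shear flow h = H satisfies [solitary_wave] whatever its Froude number. *)
Definition nontrivial_wave m h H : Prop :=
  exists2 x, closed_strip m x & h x <> H x.2.

Definition is_froude_number g m Hp (F : R) : Prop :=
  0 < F /\
  1 / F ^+ 2 = g * \int[@lebesgue_measure R]_(p in `[- m, 0]) (Hp p ^+ 3).

Definition wave_of_elevation h H : Prop :=
  (forall q, 0 <= elevation h H q) /\ (exists q, elevation h H q <> 0).

Definition wave_of_depression h H : Prop :=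
  (forall q, elevation h H q <= 0) /\ (exists q, elevation h H q <> 0).

End solitary_waves.

(* Main.v *)
Require Import Defs.
From HB Require Import structures.
From mathcomp Require Import all_boot all_order all_algebra.
From mathcomp Require Import all_classical all_reals all_analysis.
From mathcomp Require Import measurable_realfun ring lra.
Import Order.TTheory GRing.Theory Num.Theory.
Import numFieldNormedType.Exports.
Local Open Scope classical_set_scope.
Local Open Scope ring_scope.

(** Let [Phi(p)] be the integral of [Hp^3] over [[-m, p]], so that the Froude
    number is given by [1/F^2 = g Phi(0)].  This [Phi] spans the solutions,
    vanishing at the bottom, of the equation linearized about the shear flow at
    zero wave number.  Testing the full equation against [Phi(p) chi(q)], for a
    cutoff [chi], gives the result.

    Write [f1 = - (1 + hq^2) / (2 hp^2) + 1 / (2 Hp^2)] and [f2 = hq / hp] for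
    the fluxes of the height equation.  A direct computation
    ([flux1_remainder]) gives [f1 Hp^3 = (hp - Hp) - N], where
    [N = ((hp - Hp)^2 (Hp + 2 hp) + hq^2 Hp^3) / (2 hp^2)] is nonnegative, and
    vanishes only where [hp = Hp] and [hq = 0].  Integrating the interior
    equation against [Phi chi], and using the surface equation for the boundary
    term at [p = 0], one finds ([flux_identity])
      [int int N chi = (1 - g Phi(0)) int eta chi + int int f2 Phi chi'
                       - sigma Phi(0) int kappa chi'],
    where [kappa = hq / sqrt (1 + hq^2)] at [p = 0].  Let now [chi] be 1 on
    [[-L, L]], with a derivative that is supported in [L <= |q| <= L + 1] and has
    total variation 2.  Since [hq] tends to 0 at infinity, uniformly in [p], the
    last two terms tend to 0 as [L] tends to infinity, whatever the sign of
    [sigma].  Hence, if [(1 - g Phi(0)) eta <= 0] everywhere, then [N] vanishes,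
    so [hp = Hp] and, by the bottom condition, [h = H]
    ([flux_remainder_eq0], [wave_trivial]).  The three claims are the
    contrapositives of this fact, for [F = 1], for [F <= 1] and [eta >= 0], and
    for [F >= 1] and [eta <= 0].

    The equations are weak, and their test functions are smooth with a compact
    support inside the open strip, while [Phi chi] is only of class C^1 in [p]
    and does not vanish at [p = 0].  For this reason the equation is first tested
    against products [chi(q) psi(p)]: by Fubini's theorem, the integral over [q]
    of [f1 chi] has the integral of [f2 chi'] as a weak derivative on
    []-m, 0[].  Both are continuous up to the boundary, so this derivative is a
    classical one by the lemma of du Bois-Reymond
    ([weak_derivative_classical]), and the fundamental theorem of calculus
    applies to its product with [Phi] ([integral_primitive_parts]).  The cutoffs
    are made of translates of a smooth step, which is built from [exp (-1/x)].
    To avoid the boundary of the strip, [hp], [hq] and [Hp] are extended to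
    continuous functions on the whole plane, constant in [p] outside of
    [[-m, 0]]. *)

Set Implicit Arguments.
Unset Strict Implicit.
Unset Printing Implicit Defensive.

(** * Smooth functions *)

Section smooth_algebra.
Context {R : realType} {V : normedModType R}.
Implicit Types (B : set (V -> R)) (f g : V -> R).

(** The algebra of functions generated by [B]. *)
Inductive gen_alg B : (V -> R) -> Prop :=
| gen_alg_base f : B f -> gen_alg B f
| gen_alg_cst c : gen_alg B (cst c)
| gen_algD f g : gen_alg B f -> gen_alg B g -> gen_alg B (f + g)
| gen_algM f g : gen_alg B f -> gen_alg B g -> gen_alg B (f * g).

(** If the directional derivatives of the generators stay in the algebra that
    they generate, then this algebra is stable under differentiation, hence made
    of smooth functions. *)
Lemma gen_alg_smooth B :
  (forall f, B f -> continuous f) ->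
  (forall f, B f -> forall v, exists2 g, gen_alg B g &
     forall x, is_derive x v f (g x)) ->
  forall f, gen_alg B f -> smooth f.
Proof.
move=> Bc Bd.
have gc f : gen_alg B f -> continuous f.
  elim=> [{}f|c|{}f g _ fc _ gc|{}f g _ fc _ gc].
  - exact: Bc.
  - exact: cst_continuous.
  - by move=> x; apply: continuousD; [exact: fc|exact: gc].
  - by move=> x; apply: continuousM; [exact: fc|exact: gc].
have gd f : gen_alg B f -> forall v, exists2 g, gen_alg B g &
     forall x, is_derive x v f (g x).
  elim=> [{}f|c|{}f g fB fd gB gd|{}f g fB fd gB gd].
  - exact: Bd.
  - move=> v; exists (cst 0); first exact: gen_alg_cst.
    by move=> x; exact: is_derive_cst.
  - move=> v; have [f' f'B df] := fd v; have [g' g'B dg] := gd v.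
    exists (f' + g'); first exact: gen_algD.
    by move=> x; exact: is_deriveD.
  - move=> v; have [f' f'B df] := fd v; have [g' g'B dg] := gd v.
    exists (f * g' + g * f').
      by apply: gen_algD; apply: gen_algM.
    by move=> x; exact: is_deriveM.
move=> f fB vs.
suff dB : gen_alg B (foldr (fun v k => 'D_v k) f vs).
  split; first exact: gc.
  by move=> x v; have [g _ dg] := gd _ dB v; apply: ex_derive; exact: dg.
elim: vs => //= v vs IH.
have [g gB dg] := gd _ IH v.
suff -> : 'D_v (foldr (fun v k => 'D_v k) f vs) = g by [].
by apply/funext => x; exact: (derive_val (is_derive := dg x)).
Qed.

Lemma smooth_continuous f : smooth f -> continuous f.
Proof. by move=> /(_ [::])[]. Qed.

Lemma smooth_is_derive f x v : smooth f -> is_derive x v f ('D_v f x).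
Proof. by move=> /(_ [::])[_ df]; exact/derivableP. Qed.

Lemma smooth_derive f v : smooth f -> smooth ('D_v f).
Proof. by move=> sf vs; have := sf (rcons vs v); rewrite foldr_rcons. Qed.

Lemma derive_smooth f : continuous f -> (forall x v, derivable f x v) ->
  (forall v, smooth ('D_v f)) -> smooth f.
Proof.
move=> fc df sdf vs; case/lastP: vs => [//|vs v].
by rewrite foldr_rcons; exact: sdf.
Qed.

Lemma foldr_derive_smooth f vs : smooth f ->
  smooth (foldr (fun v k => 'D_v k) f vs).
Proof.
move=> sf; elim: vs => [|v vs IH]; [exact: sf|exact: smooth_derive].
Qed.

Let smooth_gen_alg B f : (forall f, B f -> smooth f) ->
  (forall f, B f -> forall v, B ('D_v f)) -> gen_alg B f -> smooth f.
Proof.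
move=> Bs Bd; apply: gen_alg_smooth => {}f Bf; first exact/smooth_continuous/Bs.
move=> v; exists ('D_v f); first exact/gen_alg_base/Bd.
by move=> x; apply: smooth_is_derive; exact: Bs.
Qed.

Lemma smooth_gen f : gen_alg (fun f => smooth f) f -> smooth f.
Proof.
apply: smooth_gen_alg => [{}f sf|{}f sf v]; [exact: sf|exact: smooth_derive].
Qed.

Lemma smooth_cst (c : R) : smooth (cst c : V -> R).
Proof. by apply: smooth_gen; exact: gen_alg_cst. Qed.

Lemma smoothD f g : smooth f -> smooth g -> smooth (f + g).
Proof. by move=> sf sg; apply: smooth_gen; apply: gen_algD; exact: gen_alg_base. Qed.

Lemma smoothM f g : smooth f -> smooth g -> smooth (f * g).
Proof. by move=> sf sg; apply: smooth_gen; apply: gen_algM; exact: gen_alg_base. Qed.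

End smooth_algebra.

Section smooth_comp.
Context {R : realType} {V W : normedModType R}.

(** The chain rule for an affine map [A] with linear part [L]: the difference
    quotients of [f \o A] are literally those of [f]. *)
Lemma is_derive_comp_affine (A L : V -> W) (f : W -> R) x v df :
  (forall h v x, A (h *: v + x) = h *: L v + A x) ->
  is_derive (A x) (L v) f df -> is_derive x v (f \o A) df.
Proof.
move=> AL fd.
have E : (fun h => h^-1 *: (((f \o A) \o shift x) (h *: v) - (f \o A) x)) =
   (fun h => h^-1 *: ((f \o shift (A x)) (h *: L v) - f (A x))).
  by apply/funext => h /=; rewrite AL.
split.
  rewrite /derivable E; exact: (ex_derive (is_derive := fd)).
rewrite /derive E; exact: (derive_val (is_derive := fd)).
Qed.

Lemma smooth_comp_affine (A L : V -> W) (f : W -> R) :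
  continuous A -> (forall h v x, A (h *: v + x) = h *: L v + A x) ->
  smooth f -> smooth (f \o A).
Proof.
move=> Ac AL sf vs.
have -> : foldr (fun v k => 'D_v k) (f \o A) vs =
    foldr (fun v k => 'D_v k) f (map L vs) \o A.
  elim: vs => //= v vs ->; apply/funext => x.
  apply: (derive_val (is_derive := is_derive_comp_affine AL _)).
  exact/smooth_is_derive/foldr_derive_smooth.
have sF := foldr_derive_smooth (map L vs) sf.
split.
  move=> x; apply: continuous_comp; first exact: Ac.
  exact: smooth_continuous.
move=> x v.
by have [] := is_derive_comp_affine AL (smooth_is_derive (A x) (L v) sF).
Qed.

End smooth_comp.

Section line_smooth.
Context {R : realType}.
Implicit Types (f g : R -> R) (x v c : R).

Lemma is_derive1_dir f x v df : is_derive x 1 f df -> is_derive x v f (v * df).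
Proof.
move=> fd.
have dv := ex_derive (is_derive := fd).
have df1 : differentiable f x by apply/derivable1_diffP.
have E := derive_val (is_derive := fd).
split; first exact: diff_derivable.
by rewrite deriveE// deriv1E// derive1E E.
Qed.

Lemma is_derive1_continuous f x df : is_derive x 1 f df -> {for x, continuous f}.
Proof.
move=> fd; apply: differentiable_continuous; apply/derivable1_diffP.
exact: (ex_derive (is_derive := fd)).
Qed.

Lemma primitive_smooth f g : (forall x, is_derive x 1 f (g x)) -> smooth g ->
  smooth f.
Proof.
move=> fg sg; apply: derive_smooth.
- by move=> x; apply: is_derive1_continuous.
- by move=> x v; have [] := is_derive1_dir v (fg x).
move=> v.
have -> : 'D_v f = cst v * g.
  by apply/funext => x; have [_ ->] := is_derive1_dir v (fg x).
exact/smoothM/sg/smooth_cst.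
Qed.

Lemma smooth_affine f a b : smooth f -> smooth (fun x => f (a * x + b)).
Proof.
apply: (@smooth_comp_affine _ R R (fun x => a * x + b) (fun x => a * x)).
- move=> x; apply: continuousD; last exact: cvg_cst.
  by apply: continuousM; [exact: cvg_cst|exact: cvg_id].
- by move=> h v x; rewrite /GRing.scale/=; ring.
Qed.

(** [x^-n * exp(-1/x)] on the positive half-line, extended by zero. *)
Definition flat_exp n x : R := if 0 < x then x ^- n * expR (- x^-1) else 0.

Lemma flat_exp_ge0 n x : 0 <= flat_exp n x.
Proof.
rewrite /flat_exp; case: ifPn => // x0.
by rewrite mulr_ge0 ?expR_ge0// invr_ge0 exprn_ge0// ltW.
Qed.

Lemma flat_exp_le0 n x : x <= 0 -> flat_exp n x = 0.
Proof. by move=> x0; rewrite /flat_exp ltNge x0. Qed.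

Lemma flat_exp_gt0 n x : 0 < x -> 0 < flat_exp n x.
Proof. by move=> x0; rewrite /flat_exp x0 mulr_gt0 ?expR_gt0// invr_gt0 exprn_gt0. Qed.

Lemma flat_exp_le_sqr n x : flat_exp n x <= (n.+2)`!%:R * x ^+ 2.
Proof.
have [x0|x0] := ltP 0 x; last first.
  by rewrite flat_exp_le0// mulr_ge0// ?ler0n// sqr_ge0.
rewrite /flat_exp x0 expRN.
have y0 : 0 <= x^-1 by rewrite invr_ge0 ltW.
have /(le_trans _) := expR_ge1Dxn n.+1 y0.
move=> /(_ (x^-1 ^+ n.+2 / n.+2`!%:R)); rewrite lerDr ler01 => /(_ isT) h.
have f0 : 0 < (n.+2)`!%:R :> R by rewrite ltr0n fact_gt0.
have p0 : 0 < x^-1 ^+ n.+2 / n.+2`!%:R by rewrite divr_gt0// exprn_gt0// invr_gt0.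
have : (expR x^-1)^-1 <= (x^-1 ^+ n.+2 / n.+2`!%:R)^-1.
  by rewrite lef_pV2// posrE ?expR_gt0.
have xn0 : 0 < x ^- n by rewrite invr_gt0 exprn_gt0.
rewrite -(ler_pM2l xn0) => /le_trans; apply.
rewrite invf_div exprVn invrK -addn2 exprD mulrCA.
by rewrite [x ^- n * _]mulrA mulVf ?mul1r// expf_neq0// gt_eqF.
Qed.

Lemma is_derive_sqr_bound f C : (forall x, `|f x| <= C * x ^+ 2) ->
  is_derive (0 : R) (1 : R) f 0.
Proof.
move=> fC.
have f0 : f 0 = 0.
  by apply/eqP; rewrite -normr_le0 (le_trans (fC 0))// expr0n mulr0.
have C0 : 0 <= C by have := fC 1; rewrite expr1n mulr1; apply: le_trans.
suff h : (fun h : R => h^-1 *: ((f \o shift 0) (h *: (1 : R)) - f 0)) @ 0^' --> (0 : R).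
  split; first by apply/cvg_ex; exists 0.
  exact: cvg_lim.
apply/cvgr0Pnorm_le => e e0.
have Ce : 0 < e / (C + 1) by rewrite divr_gt0// ltr_wpDl.
near=> h.
have hn : h != 0 by near: h; exact: nbhs_dnbhs_neq.
rewrite /= addr0 f0 subr0 /GRing.scale/= mulr1 normrM normfV.
rewrite ler_pdivrMl ?normr_gt0// (le_trans (fC h))//.
rewrite -real_normK ?num_real// expr2 mulrCA ler_wpM2l//.
have : `|h| <= e / (C + 1).
  near: h; apply: dnbhs0_le; exact: Ce.
rewrite ler_pdivlMr ?ltr_wpDl// => /(le_trans _); apply.
by rewrite mulrC ler_wpM2l// lerDl.
Unshelve. all: by end_near. Qed.

Lemma is_derive_flat_exp n x :
  is_derive x 1 (flat_exp n) (- n%:R * flat_exp n.+1 x + flat_exp n.+2 x).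
Proof.
have [x0|x0|->] := ltrgtP x 0; last first.
- rewrite !flat_exp_le0// mulr0 addr0.
  apply: (@is_derive_sqr_bound _ (n.+2)`!%:R) => y.
  by rewrite ger0_norm ?flat_exp_ge0// flat_exp_le_sqr.
- have h : \forall y \near x, y^-1 ^+ n * expR (- y^-1) = flat_exp n y.
    near=> y; rewrite /flat_exp exprVn ifT//.
    by near: y; exact: lt_nbhsr.
  apply: near_eq_is_derive h _.
  have xn : x != 0 by rewrite gt_eqF.
  have dV : is_derive x (1 : R) (fun y => y^-1 : R) (- x ^- 2).
    apply: is_derive_eq; first exact: is_deriveV.
    by rewrite /GRing.scale/= mulr1.
  have dE : is_derive x (1 : R) (fun y : R => expR (- y^-1)) (x ^- 2 * expR (- x^-1)).
    have := @is_derive1_comp _ expR (fun y : R => - y^-1) x _ _ (is_derive_expR _) (is_deriveN dV).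
    by move=> d; apply: (is_derive_eq d); rewrite opprK mulrC.
  have := is_deriveM (is_deriveX n dV) dE.
  have -> : (fun y : R => y^-1 ^+ n * expR (- y^-1)) =
      (fun y => y^-1) ^+ n * (fun y => expR (- y^-1)).
    by apply/funext => y; rewrite fctE exprfctE.
  move=> d; apply: (is_derive_eq d); move: {d} n => n.
  rewrite /flat_exp x0 /GRing.scale/=.
  rewrite -!exprVn; set y := x^-1; set E := expR _.
  rewrite exprfctE -/y; case: n => [|n]; first by rewrite /= !expr0; ring.
  by rewrite /= !exprS; ring.
- rewrite !flat_exp_le0 ?ltW// mulr0 addr0.
  have h : \forall y \near x, (cst 0 : R -> R) y = flat_exp n y.
    near=> y; rewrite /flat_exp ifF//; apply/negbTE; rewrite -leNgt ltW//.
    by near: y; exact: lt_nbhsl.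
  exact: near_eq_is_derive h _.
Unshelve. all: by end_near. Qed.

Lemma smooth_flat_exp n : smooth (flat_exp n).
Proof.
apply: (@gen_alg_smooth _ _ [set f | exists n, f = flat_exp n]); last first.
- by apply: gen_alg_base; exists n.
- move=> _ [k ->] v.
  exists (cst v * (cst (- k%:R) * flat_exp k.+1 + flat_exp k.+2)).
    apply: gen_algM; first exact: gen_alg_cst.
    apply: gen_algD; last by apply: gen_alg_base; exists k.+2.
    by apply: gen_algM; [exact: gen_alg_cst|apply: gen_alg_base; exists k.+1].
  by move=> x; exact/is_derive1_dir/is_derive_flat_exp.
- move=> _ [k ->] x; exact/is_derive1_continuous/is_derive_flat_exp.
Qed.

End line_smooth.

(** * Functions vanishing outside of a set *)

Section support.
Context d (T : measurableType d) {R : realType} (mu : {measure set T -> \bar R}).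
Implicit Types (f : T -> R) (D E : set T).

Lemma integrable_supp f D E : measurable D -> measurable E ->
  mu.-integrable E (EFin \o f) -> (forall x, D x -> ~ E x -> f x = 0) ->
  mu.-integrable D (EFin \o f).
Proof.
move=> mD mE /(integrable_mkcond _ mE) fE f0.
have : mu.-integrable D ((EFin \o f) \_ E).
  by apply: (@integrableS _ _ _ mu setT).
apply: eq_integrable => // x /set_mem Dx; rewrite /patch.
by case: ifPn => // /negP xE; rewrite /= f0// => /mem_set.
Qed.

Lemma Rintegral_supp f D E : (forall x, D x -> ~ E x -> f x = 0) ->
  (forall x, E x -> ~ D x -> f x = 0) ->
  \int[mu]_(x in D) f x = \int[mu]_(x in E) f x.
Proof.
move=> DE ED; rewrite Rintegral_mkcond [RHS]Rintegral_mkcond.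
congr Rintegral; apply/funext => x; rewrite /patch.
have [/set_mem Dx|/negP Dx] := boolP (x \in D);
  have [/set_mem Ex|/negP Ex] := boolP (x \in E) => //.
- by apply: DE => // /mem_set.
- by apply/esym; apply: ED => // /mem_set.
Qed.

End support.

(** * Integrals over segments *)

Section segment_integral.
Context {R : realType}.
Local Notation mu := (@lebesgue_measure R).
Implicit Types (f F : R -> R) (a b x : R).

Lemma within_integrable f a b : {within `[a, b], continuous f} ->
  mu.-integrable `[a, b] (EFin \o f).
Proof. by apply: continuous_compact_integrable; exact: segment_compact. Qed.

Lemma continuous_integrable f a b : continuous f ->
  mu.-integrable `[a, b] (EFin \o f).
Proof. by move=> fc; apply: within_integrable; exact: continuous_subspaceT. Qed.

Lemma FTC2_segment f F a b : a < b -> {within `[a, b], continuous f} ->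
  {within `[a, b], continuous F} ->
  (forall x, a < x < b -> is_derive x 1 F (f x)) ->
  \int[mu]_(x in `[a, b]) f x = F b - F a.
Proof.
move=> ab fc Fc dF.
rewrite /Rintegral (@continuous_FTC2 _ f F)//=.
  have [_ Fa Fb] := (continuous_within_itvP F ab).1 Fc.
  by split=> // x; rewrite in_itv/= => xab; have [] := dF _ xab.
move=> x; rewrite in_itv/= => xab.
by rewrite derive1E; have [_ ->] := dF _ xab.
Qed.

Lemma is_derive_integral f a b x : mu.-integrable `[a, b] (EFin \o f) ->
  a < x < b -> {for x, continuous f} ->
  is_derive x 1 (fun y => \int[mu]_(t in `[a, y]) f t) (f x).
Proof.
move=> fi /andP[ax xb] fx.
have [d e] := continuous_FTC1 (a := BLeft a) xb fi ax fx.
by split; [exact: d | rewrite -derive1E].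
Qed.

Lemma within_continuous_at f a b x : {within `[a, b], continuous f} ->
  a < x < b -> {for x, continuous f}.
Proof.
move=> fc /andP[ax xb]; have ab := lt_trans ax xb.
by have [+ _ _] := (continuous_within_itvP f ab).1 fc; apply; rewrite in_itv/= ax.
Qed.

Lemma integral_segment_eq0 f a b : {within `[a, b], continuous f} ->
  (forall x, a <= x <= b -> 0 <= f x) -> \int[mu]_(x in `[a, b]) f x <= 0 ->
  forall x, a < x < b -> f x = 0.
Proof.
move=> fc f0 If x /andP[ax xb].
have fi := within_integrable fc.
pose F y := \int[mu]_(t in `[a, y]) f t.
have F0 y : y < b -> F y = 0.
  move=> yb; apply/eqP; rewrite eq_le Rintegral_ge0 ?andbT; last first.
    move=> t; rewrite /= in_itv/= => /andP[at_ ty]; apply: f0.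
    by rewrite at_ (le_trans ty)// ltW.
  apply: le_trans If; rewrite /F/Rintegral; apply: fine_le.
  - apply: integrable_fin_num => //; apply: integrableS fi => //.
    by apply: subset_itvl; rewrite bnd_simp ltW.
  - exact: integrable_fin_num.
  - apply: ge0_subset_integral => //.
    + by case/integrableP : fi.
    + by apply: subset_itvl; rewrite bnd_simp ltW.
have xab : a < x < b by rewrite ax.
have dF := is_derive_integral fi xab (within_continuous_at fc xab).
have dF0 : is_derive x (1 : R) F 0.
  have h : \forall y \near x, (cst 0 : R -> R) y = F y.
    by near=> y; rewrite F0//; near: y; exact: lt_nbhsl.
  exact: near_eq_is_derive h _.
by rewrite -(derive_val (is_derive := dF)) (derive_val (is_derive := dF0)).
Unshelve. all: by end_near. Qed.

Lemma normr_Rintegral_le_mul f (g : R -> R) a b e :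
  continuous f -> continuous g -> (forall x, a <= x <= b -> `|f x| <= e * g x) ->
  `|\int[mu]_(x in `[a, b]) f x| <= e * \int[mu]_(x in `[a, b]) g x.
Proof.
move=> fc gc fg; have gi := continuous_integrable a b gc.
rewrite -RintegralZl//.
apply: le_trans (le_normr_Rintegral _ (continuous_integrable a b fc)) _ => //.
apply: le_Rintegral => //.
- exact/integrable_norm/continuous_integrable.
- apply: continuous_integrable => x.
  by apply: continuousM; [exact: cst_continuous|exact: gc].
Qed.

End segment_integral.

(** * A smooth step *)

Section smooth_step.
Context {R : realType}.
Local Notation mu := (@lebesgue_measure R).

Let bump (x : R) : R := flat_exp 0 x * flat_exp 0 (- 1 * x + 1).

Let bump_smooth : smooth bump.
Proof.
apply: (smoothM (smooth_flat_exp 0)).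
exact: (smooth_affine (- 1) 1 (smooth_flat_exp 0)).
Qed.

Let bump_ge0 (x : R) : 0 <= bump x.
Proof. by rewrite mulr_ge0// flat_exp_ge0. Qed.

Let bump_gt0 (x : R) : 0 < x < 1 -> 0 < bump x.
Proof. by move=> /andP[x0 x1]; rewrite mulr_gt0// flat_exp_gt0//; lra. Qed.

Let bump_out (x : R) : x <= 0 \/ 1 <= x -> bump x = 0.
Proof.
rewrite /bump; case=> h; first by rewrite flat_exp_le0// mul0r.
by rewrite [X in _ * X]flat_exp_le0 ?mulr0//; lra.
Qed.

Let prim (x : R) : R := \int[mu]_(t in `]-oo, x]) bump t.

Let prim_seg (x : R) : prim x = \int[mu]_(t in `[0, x]) bump t.
Proof.
apply: Rintegral_supp => t /=; rewrite !in_itv/=; last by move=> /andP[_ ->].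
by move=> tx /negP; rewrite tx andbT -ltNge => t0; rewrite bump_out// ltW//; left.
Qed.

Let bump_integrable u : mu.-integrable `]-oo, u] (EFin \o bump).
Proof.
apply: (@integrable_supp _ _ _ mu _ _ `[0, 1]) => //.
  exact/continuous_integrable/smooth_continuous.
move=> t _ /=; rewrite in_itv/= => /negP.
rewrite negb_and -!ltNge => /orP[] /ltW h; rewrite /= bump_out//; [by left|by right].
Qed.

Let is_derive_prim (x : R) : is_derive x (1 : R) prim (bump x).
Proof.
have x1 : x < x + 1 by rewrite ltrDl.
have [d e] := continuous_FTC1 (a := -oo%O) x1 (bump_integrable _) (ltNyr x)
  (@smooth_continuous _ _ _ bump_smooth x).
by split; [exact: d|rewrite -derive1E].
Qed.

Let prim_le0 (x : R) : x <= 0 -> prim x = 0.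
Proof.
move=> x0; rewrite -(Rintegral_set0 mu bump); apply: Rintegral_supp => // t /=.
by rewrite in_itv/= => tx _; rewrite bump_out//; left; exact: le_trans tx x0.
Qed.

Let prim_ge1 (x : R) : 1 <= x -> prim x = prim 1.
Proof.
move=> x1; apply: Rintegral_supp => t /=; rewrite !in_itv/=.
  by move=> _ /negP; rewrite -ltNge => /ltW h; rewrite bump_out//; right.
by move=> t1; rewrite (le_trans t1).
Qed.

Let prim_nd (x y : R) : x <= y -> prim x <= prim y.
Proof.
move=> xy; have pc z : {for z, continuous prim}.
  exact: is_derive1_continuous (is_derive_prim z).
have [z _ e] := MVT_segment xy (fun z _ => is_derive_prim z)
  (continuous_subspaceT pc).
by rewrite -subr_ge0 e mulr_ge0// subr_ge0.
Qed.

Let prim1_gt0 : 0 < prim 1.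
Proof.
rewrite lt_neqAle -{2}(prim_le0 (lexx 0)) prim_nd// andbT eq_sym; apply/eqP => p1.
have h : 0 < (2^-1 : R) < 1 by apply/andP; split; lra.
have := bump_gt0 h.
rewrite (@integral_segment_eq0 _ bump 0 1) ?ltxx//.
- exact/continuous_subspaceT/smooth_continuous.
- by rewrite -prim_seg p1.
Qed.

(** A smooth nondecreasing step from 0, on the negative half-line, to 1, past
    the point 1. *)
Lemma smooth_step_exists : exists T t : R -> R,
  [/\ smooth T, smooth t & forall x : R, is_derive x (1 : R) T (t x)] /\
  [/\ forall x, x <= 0 -> T x = 0, forall x, 1 <= x -> T x = 1 &
      forall x y, x <= y -> T x <= T y] /\
  [/\ forall x, 0 <= t x, forall x, 0 < x < 1 -> 0 < t x &
      forall x, x <= 0 \/ 1 <= x -> t x = 0].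
Proof.
pose c := (prim 1)^-1; have c0 : 0 < c by rewrite invr_gt0.
exists (cst c * prim), (cst c * bump); split; [|split]; split.
- apply/smoothM/(primitive_smooth is_derive_prim bump_smooth)/smooth_cst.
- exact/smoothM/bump_smooth/smooth_cst.
- by move=> x; exact: is_deriveZ.
- by move=> x x0; rewrite fctE prim_le0// mulr0.
- by move=> x x1; rewrite fctE prim_ge1// mulVf// gt_eqF.
- by move=> x y xy; rewrite !fctE ler_pM2l// prim_nd.
- by move=> x; rewrite fctE mulr_ge0// ltW.
- by move=> x x01; rewrite fctE mulr_gt0// bump_gt0.
- by move=> x xo; rewrite fctE bump_out// mulr0.
Qed.

End smooth_step.

(** * Test functions *)

Section steps.
Context {R : realType}.
Local Notation mu := (@lebesgue_measure R).

(** [T] is a smooth nondecreasing step, with derivative [t], climbing from 0 to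
    1 on [[a, a + e]]. *)
Record is_step (a e : R) (T t : R -> R) : Prop := IsStep {
  step_smooth : smooth T;
  dstep_smooth : smooth t;
  step_derive : forall x : R, is_derive x (1 : R) T (t x);
  step_eq0 : forall x, x <= a -> T x = 0;
  step_eq1 : forall x, a + e <= x -> T x = 1;
  step_le : forall x y, x <= y -> T x <= T y;
  dstep_ge0 : forall x, 0 <= t x;
  dstep_gt0 : forall x, a < x < a + e -> 0 < t x;
  dstep_eq0 : forall x, x <= a \/ a + e <= x -> t x = 0
}.

Lemma is_step_exists (a e : R) : 0 < e -> exists T t, is_step a e T t.
Proof.
move=> e0; have [T [t [[sT st dT] [[T0 T1 Tle] [t0 tgt teq]]]]] := @smooth_step_exists R.
have ei : 0 < e^-1 by rewrite invr_gt0.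
have A0 (x : R) : e^-1 * x + - (a / e) = (x - a) / e by ring.
have Ale0 (x : R) : x <= a -> e^-1 * x + - (a / e) <= 0.
  by move=> xa; rewrite A0 ler_pdivrMr// mul0r subr_le0.
have Age1 (x : R) : a + e <= x -> 1 <= e^-1 * x + - (a / e).
  by move=> xa; rewrite A0 ler_pdivlMr// mul1r lerBrDl.
exists (fun x => T (e^-1 * x + - (a / e))).
exists (cst e^-1 * (fun x => t (e^-1 * x + - (a / e)))).
split.
- exact: (smooth_affine e^-1 (- (a / e)) sT).
- apply: (smoothM (smooth_cst _)).
  exact: (smooth_affine e^-1 (- (a / e)) st).
- move=> x.
  apply: (@is_derive_comp_affine _ R R (fun x => e^-1 * x + - (a / e))
      (fun x => e^-1 * x)).
    by move=> h v y; rewrite /GRing.scale/=; ring.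
  rewrite mulr1; exact: is_derive1_dir.
- by move=> x /Ale0; exact: T0.
- by move=> x /Age1; exact: T1.
- by move=> x y xy; apply: Tle; rewrite lerD2r ler_pM2l.
- by move=> x; rewrite fctE mulr_ge0// ltW.
- move=> x /andP[ax xe]; rewrite fctE mulr_gt0// tgt// A0.
  by rewrite divr_gt0 ?subr_gt0// ltr_pdivrMr// mul1r ltrBlDl.
- move=> x h; rewrite fctE teq ?mulr0//.
  by case: h => [/Ale0|/Age1]; [left|right].
Qed.

Variables (a e : R) (T t : R -> R).
Hypothesis Tt : is_step a e T t.

Lemma step_ge0 x : 0 <= T x.
Proof.
have [xa|ax] := leP x a; first by rewrite (step_eq0 Tt).
by rewrite -(step_eq0 Tt (lexx a)); apply: (step_le Tt); exact: ltW.
Qed.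

Lemma step_le1 x : T x <= 1.
Proof.
have [xa|ax] := leP (a + e) x; first by rewrite (step_eq1 Tt).
by rewrite -(step_eq1 Tt (lexx (a + e))); apply: (step_le Tt); exact: ltW.
Qed.

Lemma integral_dstep b c : b < c -> b <= a -> a + e <= c ->
  \int[mu]_(x in `[b, c]) t x = 1.
Proof.
move=> bc ba ec.
have tc := smooth_continuous (dstep_smooth Tt).
have Tc := smooth_continuous (step_smooth Tt).
rewrite (FTC2_segment bc (continuous_subspaceT tc) (continuous_subspaceT Tc)
  (fun x _ => step_derive Tt x)).
by rewrite (step_eq1 Tt)// (step_eq0 Tt)// subr0.
Qed.

End steps.

Lemma test_function_supp (R : realType) (V : normedModType R) (U K : set V)
    (phi : V -> R) :
  smooth phi -> compact K -> K `<=` U -> (forall x, ~ K x -> phi x = 0) ->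
  test_function U phi.
Proof.
move=> sphi Kc KU phi0.
have Kcl : closed K by apply: compact_closed => //; exact: norm_hausdorff.
have supK : closure [set x | phi x != 0] `<=` K.
  rewrite [X in _ `<=` X](closure_id K).1//; apply: closure_subset => x /=.
  by apply: contraNP => /phi0 ->.
split; [exact: sphi| |exact: subset_trans KU].
exact: subclosed_compact (@closed_closure _ _) Kc supK.
Qed.

(** * Continuous functions on the plane *)

Section plane.
Context {R : realType}.
Local Notation mu := (@lebesgue_measure R).
Implicit Types (G : R * R -> R) (a b c d : R).

(** An open set is a countable union of products of balls with rational centres
    and radii, hence belongs to the product sigma-algebra. *)
Lemma open_measurable_plane (U : set (R * R)) : open U -> measurable U.
Proof.
move=> oU.
pose B (x y r : rat) : set (R * R) :=
  ball (ratr x : R) (ratr r) `*` ball (ratr y : R) (ratr r).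
have -> : U = \bigcup_x \bigcup_y \bigcup_(r in [set r | B x y r `<=` U]) B x y r.
  apply/seteqP; split=> [[p q] Upq|z [x _ [y _ [r rU] /rU]]//].
  have /nbhs_ballP[e /= e0 eU] : nbhs (p, q) U by exact: open_nbhs_nbhs.
  have e2 : 0 < e / 2 by rewrite divr_gt0.
  have [r] := rat_in_itvoo e2; rewrite in_itv/= => /andP[r0 re].
  have rat_near (s : R) : exists x : rat, ball (ratr x : R) (ratr r) s.
    have [x] : exists x : rat, ratr x \in `]s - ratr r, s + ratr r[.
      by apply: rat_in_itvoo; rewrite ltrBlDr -addrA ltrDl addr_gt0.
    by rewrite in_itv/= => sx; exists x; rewrite /ball/= ltr_distl; lra.
  have [x px] := rat_near p; have [y qy] := rat_near q.
  exists x => //; exists y => //; exists r => //= -[p' q'] [/= p'x q'y].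
  have tri (z s s' : R) : ball z (ratr r) s -> ball z (ratr r) s' -> ball s e s'.
    by rewrite /ball/= !ltr_distl; lra.
  by apply: eU; split=> /=; [exact: tri px p'x|exact: tri qy q'y].
apply: bigcupT_measurable_rat => x; apply: bigcupT_measurable_rat => y.
rewrite bigcup_mkcond; apply: bigcupT_measurable_rat => r.
by case: ifPn => // _; apply: measurableX; rewrite ball_itv; exact: measurable_itv.
Qed.

Lemma continuous_measurable_plane G : continuous G -> measurable_fun setT G.
Proof.
move=> /continuousP Gc.
apply: (measurability _ (RGenOpens.measurableE R)).
move=> _ [_ [a [b ->] <-]]; rewrite setTI; apply: open_measurable_plane.
exact/Gc/interval_open.
Qed.

(** The closed rectangle of the [(q, p)] with [q] in [[a, b]] and [p] in [[c, d]]. *)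
Definition rect a b c d : set (R * R) := `[a, b]%classic `*` `[c, d]%classic.

Lemma compact_rect a b c d : compact (rect a b c d).
Proof. by apply: compact_setX; exact: segment_compact. Qed.

Lemma measurable_rect a b c d : measurable (rect a b c d).
Proof. by apply: measurableX; exact: measurable_itv. Qed.

Lemma continuous_rect_bound G a b c d : continuous G ->
  exists M, forall x, rect a b c d x -> `|G x| <= M.
Proof.
move=> Gc.
have : compact (G @` rect a b c d).
  apply: continuous_compact; last exact: compact_rect.
  exact: continuous_subspaceT.
move=> /compact_bounded[M [_ MG]]; exists (M + 1) => x rx.
by apply: MG; [rewrite ltrDl|exists x].
Qed.

Lemma rect_measure_lty a b c d : (lebesgue_plane (rect a b c d) < +oo)%E.
Proof.
rewrite /lebesgue_plane /rect product_measure1E; [|exact: measurable_itv..].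
suff : ((mu `[a, b]%classic * mu `[c, d]%classic) < +oo)%E by [].
rewrite !lebesgue_measure_itv/=.
by case: ifPn => _; case: ifPn => _; rewrite ?mule0 ?mul0e// -?EFinB -?EFinM ltry.
Qed.

Lemma continuous_integrable_rect G a b c d : continuous G ->
  (@lebesgue_plane R).-integrable (rect a b c d) (EFin \o G).
Proof.
move=> Gc; apply: measurable_bounded_integrable.
- exact: measurable_rect.
- exact: rect_measure_lty.
- by apply: measurable_funTS; exact: continuous_measurable_plane.
have [M MG] := continuous_rect_bound a b c d Gc.
exists M; split; first exact: num_real.
by move=> x Mx z /MG /le_trans; apply; exact: ltW.
Qed.

End plane.

Section plane_fubini.
Context {R : realType}.
Local Notation mu := (@lebesgue_measure R).
Implicit Types (G : R * R -> R) (a b c d p q : R).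

Lemma continuous_slice1 G p : continuous G -> continuous (fun q => G (q, p)).
Proof.
move=> Gc q; apply: (cvg_comp (fun q => (q, p)) G); last exact: Gc.
by apply: (@cvg_pair _ _ _ _ (nbhs q) (nbhs p)); [exact: cvg_id|exact: cvg_cst].
Qed.

Lemma continuous_slice2 G q : continuous G -> continuous (fun p => G (q, p)).
Proof.
move=> Gc p; apply: (cvg_comp (fun p => (q, p)) G); last exact: Gc.
by apply: (@cvg_pair _ _ _ _ (nbhs q) (nbhs p)); [exact: cvg_cst|exact: cvg_id].
Qed.

Lemma EFin_Rintegral f a b : continuous f ->
  (\int[mu]_(x in `[a, b]) (f x)%:E)%E = (\int[mu]_(x in `[a, b]) f x)%:E.
Proof.
move=> fc; rewrite /Rintegral fineK//; apply: integrable_fin_num => //.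
exact: continuous_integrable.
Qed.

Lemma fubini_rect G a b c d : continuous G ->
  \int[lebesgue_plane]_(z in rect a b c d) G z =
    \int[mu]_(p in `[c, d]) \int[mu]_(q in `[a, b]) G (q, p) /\
  \int[lebesgue_plane]_(z in rect a b c d) G z =
    \int[mu]_(q in `[a, b]) \int[mu]_(p in `[c, d]) G (q, p).
Proof.
move=> Gc; set f := ((EFin \o G) \_ (rect a b c d)).
have fi : lebesgue_plane.-integrable setT f.
  exact: (integrable_mkcond (mu := lebesgue_plane) (EFin \o G)
    (measurable_rect a b c d)).1 (continuous_integrable_rect _ _ _ _ Gc).
split; rewrite {1}/Rintegral integral_mkcond -/f; congr fine.
- rewrite -(integral21_prod_meas1 fi) [RHS]integral_mkcond.
  apply: eq_integral => p _; rewrite /patch; case: ifPn => pcd.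
    rewrite -EFin_Rintegral; last exact: continuous_slice1.
    rewrite [RHS]integral_mkcond; apply: eq_integral => q _.
    by rewrite /f /patch /rect in_setX pcd andbT.
  apply: integral0_eq => q _.
  by rewrite /f /patch /rect in_setX (negbTE pcd) andbF.
- rewrite -(integral12_prod_meas1 fi) [RHS]integral_mkcond.
  apply: eq_integral => q _; rewrite /patch; case: ifPn => qab.
    rewrite -EFin_Rintegral; last exact: continuous_slice2.
    rewrite [RHS]integral_mkcond; apply: eq_integral => p _.
    by rewrite /f /patch /rect in_setX qab.
  apply: integral0_eq => p _.
  by rewrite /f /patch /rect in_setX (negbTE qab).
Qed.

Lemma continuous_parametric G a b : continuous G ->
  continuous (fun p => \int[mu]_(q in `[a, b]) G (q, p)).
Proof.
move=> Gc p.
have [M MG] := continuous_rect_bound a b (p - 1) (p + 1) Gc.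
have pI : p \in `]p - 1, p + 1[%classic.
  by rewrite inE/= in_itv/= ltrDl gtrDl ltr01 ltrN10.
apply: (@continuity_under_integral _ _ _ mu (fun p q => G (q, p)) `[a, b]%classic
  _ (p - 1) (p + 1) _ _ (cst M)) pI => //.
- by move=> x _; exact/continuous_integrable/continuous_slice1.
- by apply: aeW => q _ x _; exact: continuous_slice2.
- exact/continuous_integrable/cst_continuous.
- move=> x /= xI; apply: aeW => q qab; apply: MG; split=> //=.
  exact: subset_itv_oo_cc.
Qed.

End plane_fubini.

(** * The weak equations tested against products of cutoffs *)

Section weak_equations.
Context {R : realType}.
Local Notation mu := (@lebesgue_measure R).
Implicit Types (G : R * R -> R) (a b c d p q m : R).

(** [chi] is a smooth function supported in [[a, b]], with derivative [dchi]. *)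
Record is_cutoff a b (chi dchi : R -> R) : Prop := IsCutoff {
  cutoff_smooth : smooth chi;
  dcutoff_smooth : smooth dchi;
  cutoff_derive : forall x : R, is_derive x (1 : R) chi (dchi x);
  cutoff_supp : forall x, ~ `[a, b]%classic x -> chi x = 0;
  dcutoff_supp : forall x, ~ `[a, b]%classic x -> dchi x = 0
}.

Lemma step_cutoff a b e S s T t : is_step a e S s -> is_step b e T t -> a <= b ->
  0 < e -> is_cutoff a (b + e) (fun x => S x - T x) (fun x => s x - t x).
Proof.
move=> Ss Tt ab e0.
have sB f g : smooth f -> smooth g -> smooth (fun x : R => f x - g x).
  move=> sf sg; have -> : (fun x : R => f x - g x) = f + cst (- 1) * g.
    by apply/funext => x; rewrite !fctE mulN1r.
  exact/(smoothD sf)/(smoothM _ sg)/smooth_cst.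
have out x : ~ `[a, b + e]%classic x -> x <= a \/ b + e <= x.
  rewrite /= in_itv/= => /negP; rewrite negb_and -!ltNge.
  by move=> /orP[/ltW|/ltW]; [left|right].
split.
- exact: sB (step_smooth Ss) (step_smooth Tt).
- exact: sB (dstep_smooth Ss) (dstep_smooth Tt).
- move=> x; exact: is_deriveB (step_derive Ss x) (step_derive Tt x).
- move=> x /out[xa|bx].
    by rewrite (step_eq0 Ss)// (step_eq0 Tt) ?subrr// (le_trans xa).
  by rewrite (step_eq1 Tt)// (step_eq1 Ss) ?subrr// (le_trans _ bx)// lerD2r.
- move=> x /out[xa|bx].
    by rewrite (dstep_eq0 Ss) ?(dstep_eq0 Tt) ?subrr//; left; rewrite ?(le_trans xa).
  rewrite (dstep_eq0 Tt) ?(dstep_eq0 Ss) ?subrr//; right => //.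
  by rewrite (le_trans _ bx)// lerD2r.
Qed.

Lemma continuous_fst (f : R -> R) : continuous f -> continuous (fun x : R * R => f x.1).
Proof. by move=> fc x; apply: (cvg_comp fst f); [exact: cvg_fst|exact: fc]. Qed.

Lemma continuous_snd (f : R -> R) : continuous f -> continuous (fun x : R * R => f x.2).
Proof. by move=> fc x; apply: (cvg_comp snd f); [exact: cvg_snd|exact: fc]. Qed.

Lemma continuousMfun (T : topologicalType) (f g : T -> R) :
  continuous f -> continuous g -> continuous (fun x => f x * g x).
Proof. by move=> fc gc x; apply: continuousM; [exact: fc|exact: gc]. Qed.

Lemma is_derive_fst (f : R -> R) (x v : R * R) df : is_derive x.1 (1 : R) f df ->
  is_derive x v (fun x => f x.1) (v.1 * df).
Proof.
move=> d; apply: (@is_derive_comp_affine _ _ _ (fst : R * R -> R) fst) => //.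
exact: is_derive1_dir.
Qed.

Lemma is_derive_snd (f : R -> R) (x v : R * R) df : is_derive x.2 (1 : R) f df ->
  is_derive x v (fun x => f x.2) (v.2 * df).
Proof.
move=> d; apply: (@is_derive_comp_affine _ _ _ (snd : R * R -> R) snd) => //.
exact: is_derive1_dir.
Qed.

Variables (a b c d m : R) (chi dchi psi dpsi : R -> R).
Hypothesis chiP : is_cutoff a b chi dchi.

Let chi_c : continuous chi := smooth_continuous (cutoff_smooth chiP).
Let dchi_c : continuous dchi := smooth_continuous (dcutoff_smooth chiP).

Section line.
Variables (f S : R -> R).
Hypothesis fS : weak_derivative_line setT f S.

Lemma locally_integrable_mul (g : R -> R) :
  locally_integrable setT S -> continuous g ->
  mu.-integrable `[a, b] (EFin \o (fun x => S x * g x)).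
Proof.
move=> [mS _ /(_ `[a, b]%classic)] /(_ (@subsetT _ _) (@segment_compact _ a b)) Sfin gc.
have gm : measurable_fun `[a, b]%classic g.
  by apply: measurable_funTS; exact: continuous_measurable_fun.
have gb : [bounded g x | x in `[a, b]%classic].
  have /compact_bounded[M [Mr MG]] : compact (g @` `[a, b]%classic).
    apply: continuous_compact; last exact: segment_compact.
    exact: continuous_subspaceT.
  by exists M; split=> // y My x xab; apply: MG My _ _; exists x.
apply: (@integrableMl _ _ _ mu _ _ (EFin \o S) g) => //.
apply/integrableP; split; last exact: Sfin.
exact/measurable_EFinP/measurable_funTS.
Qed.

Lemma weak_derivative_cutoff :
  \int[mu]_(x in `[a, b]) (f x * dchi x) = - \int[mu]_(x in `[a, b]) (S x * chi x).
Proof.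
have [_ _ /(_ chi)] := fS.
have tchi : test_function setT chi.
  apply: (@test_function_supp _ _ _ `[a, b]%classic) => //.
  - exact: cutoff_smooth chiP.
  - exact: segment_compact.
  - exact: cutoff_supp chiP.
move=> /(_ tchi) e.
have -> : \int[mu]_(x in `[a, b]) (S x * chi x) = \int[mu]_x (S x * chi x).
  by apply: Rintegral_supp => [x _ []//|x _ xab]; rewrite (cutoff_supp chiP)// mulr0.
rewrite -e.
have -> : \int[mu]_x (f x * 'D_1 chi x) = \int[mu]_x (f x * dchi x).
  by apply: eq_Rintegral => x _; have [_ ->] := cutoff_derive chiP x.
by apply: Rintegral_supp => [x _ []//|x _ xab]; rewrite (dcutoff_supp chiP)// mulr0.
Qed.

Lemma surface_equation_cutoff (sigma : R) (E : R -> R) : continuous E ->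
  {ae mu, forall q, E q - sigma * S q = 0} ->
  \int[mu]_(x in `[a, b]) (E x * chi x) =
    - sigma * \int[mu]_(x in `[a, b]) (f x * dchi x).
Proof.
move=> Ec ES.
have [_ Sloc _] := fS.
rewrite weak_derivative_cutoff mulrNN -RintegralZl//; last exact: locally_integrable_mul.
congr fine; apply: ae_eq_integral => //.
- apply/measurable_EFinP; apply: measurable_funTS.
  by apply: continuous_measurable_fun; exact: continuousMfun.
- apply/measurable_EFinP/measurable_funTS; apply: measurable_funM => //.
  apply: measurable_funM; last exact: continuous_measurable_fun.
  by case: Sloc.
move: ES; apply: filterS; first exact: (ae_filter_ringOfSetsType mu).
move=> x Ex _; rewrite mulrA; congr (_ * _)%:E.
by apply/eqP; rewrite -subr_eq0 Ex.
Qed.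

End line.

Section plane.
Hypothesis psiP : is_cutoff c d psi dpsi.
Hypotheses (mc : - m < c) (d0 : d < 0).

Let psi_c : continuous psi := smooth_continuous (cutoff_smooth psiP).
Let dpsi_c : continuous dpsi := smooth_continuous (dcutoff_smooth psiP).

Let phi (x : R * R) : R := chi x.1 * psi x.2.

Let phi_smooth : smooth phi.
Proof.
apply: (@smoothM _ _ (chi \o fst) (psi \o snd)).
- apply: (@smooth_comp_affine _ (R * R)%type R fst fst) => //.
    by move=> x; exact: cvg_fst.
  exact: cutoff_smooth chiP.
- apply: (@smooth_comp_affine _ (R * R)%type R snd snd) => //.
    by move=> x; exact: cvg_snd.
  exact: cutoff_smooth psiP.
Qed.

Let derive_phi (v x : R * R) :
  'D_v phi x = v.1 * (dchi x.1 * psi x.2) + v.2 * (chi x.1 * dpsi x.2).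
Proof.
have [_ ->] := is_deriveM (is_derive_fst v (cutoff_derive chiP x.1))
  (is_derive_snd v (cutoff_derive psiP x.2)).
by rewrite /GRing.scale/=; ring.
Qed.

Let rect_strip : rect a b c d `<=` strip m.
Proof.
move=> x [_ /=]; rewrite in_itv/= => /andP[cx xd].
by rewrite /strip/= (lt_le_trans mc cx) (le_lt_trans xd d0).
Qed.

Let phi_supp x : ~ rect a b c d x -> phi x = 0.
Proof.
move=> xr; rewrite /phi.
have [x1|x1] := pselect (`[a, b]%classic x.1); last by rewrite (cutoff_supp chiP)// mul0r.
rewrite (cutoff_supp psiP) ?mulr0// => x2.
by apply: xr; split.
Qed.

Let phi_test : test_function (strip m) phi.
Proof.
exact: test_function_supp phi_smooth (@compact_rect _ a b c d) rect_strip phi_supp.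
Qed.

Let phi_c : continuous phi := smooth_continuous phi_smooth.

Lemma measurable_strip : measurable (strip m).
Proof.
have -> : strip m = setT `*` `]- m, 0[%classic.
  apply/seteqP; split=> x; rewrite /strip/= in_itv/=; first by [].
  by case.
exact: measurableX.
Qed.

Let integrable_mul_phi (A : R * R -> R) : locally_integrable_plane (strip m) A ->
  lebesgue_plane.-integrable (strip m) (EFin \o (fun x => A x * phi x)).
Proof.
move=> [mA _ /(_ _ rect_strip (@compact_rect _ a b c d)) Afin].
apply: (@integrable_supp _ _ _ lebesgue_plane _ _ (rect a b c d)).
- exact: measurable_strip.
- exact: measurable_rect.
- apply: (@integrableMl _ _ _ lebesgue_plane _ _ (EFin \o A) phi).
  + exact: measurable_rect.
  + apply/integrableP; split; last exact: Afin.
    apply/measurable_EFinP; apply: measurable_funS mA => //.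
    exact: measurable_strip.
  + by apply: measurable_funTS; exact: continuous_measurable_plane.
  have [M MG] := continuous_rect_bound a b c d phi_c.
  exists M; split; first exact: num_real.
  by move=> x Mx z /MG /le_trans; apply; exact: ltW.
- by move=> x _ xr; rewrite phi_supp// mulr0.
Qed.

(** Fubini's theorem over the strip, for an integrand that agrees there with
    [G(q, p) u(q) v(p)]. *)
Let integral_strip G (f h : R * R -> R) (u v : R -> R) : continuous G ->
  continuous u -> continuous v ->
  (forall x, strip m x -> f x = G x) -> (forall x, h x = u x.1 * v x.2) ->
  (forall x, ~ `[a, b]%classic x -> u x = 0) ->
  (forall x, ~ `[c, d]%classic x -> v x = 0) ->
  \int[lebesgue_plane]_(x in strip m) (f x * h x) =
  \int[mu]_(p in `[- m, 0]) ((\int[mu]_(q in `[a, b]) (G (q, p) * u q)) * v p).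
Proof.
move=> Gc uc vc fG hE u0 v0.
have uvc : continuous (fun x : R * R => G x * (u x.1 * v x.2)).
  apply: continuousMfun => //; apply: continuousMfun.
    exact: continuous_fst.
  exact: continuous_snd.
transitivity (\int[lebesgue_plane]_(x in rect a b (- m) 0) (G x * (u x.1 * v x.2))).
  transitivity (\int[lebesgue_plane]_(x in strip m) (G x * (u x.1 * v x.2))).
    by apply: eq_Rintegral => x /set_mem xs; rewrite fG// hE.
  apply: Rintegral_supp => x.
    move=> /andP[mx x0] xr; rewrite u0 ?mul0r ?mulr0// => x1; apply: xr.
    by split=> //=; rewrite in_itv/= !ltW.
  move=> _ xs; rewrite v0 ?mulr0// => /=; rewrite in_itv/= => /andP[cx xd]; apply: xs.
  by rewrite /strip/= (lt_le_trans mc cx) (le_lt_trans xd d0).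
rewrite (fubini_rect _ _ _ _ uvc).1; apply: eq_Rintegral => p _.
rewrite -RintegralZr//; last first.
  apply: continuous_integrable; apply: continuousMfun => //.
  exact: continuous_slice1.
by apply: eq_Rintegral => q _; rewrite /= mulrA.
Qed.

Lemma interior_equation_cutoff G1 G2 (f1 f2 A B : R * R -> R) :
  continuous G1 -> continuous G2 ->
  (forall x, strip m x -> f1 x = G1 x) -> (forall x, strip m x -> f2 x = G2 x) ->
  weak_derivative_plane (strip m) (0, 1) f1 A ->
  weak_derivative_plane (strip m) (1, 0) f2 B ->
  {ae lebesgue_plane, forall x, strip m x -> A x + B x = 0} ->
  \int[mu]_(p in `[- m, 0])
    ((\int[mu]_(q in `[a, b]) (G1 (q, p) * chi q)) * dpsi p +
     (\int[mu]_(q in `[a, b]) (G2 (q, p) * dchi q)) * psi p) = 0.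
Proof.
move=> G1c G2c f1G f2G [_ Al f1A] [_ Bl f2B] AB.
have pc G u : continuous G -> continuous u ->
    continuous (fun p => \int[mu]_(q in `[a, b]) (G (q, p) * u q)).
  move=> Gc uc; apply: (@continuous_parametric _ (fun x => G x * u x.1)).
  by apply: continuousMfun => //; exact: continuous_fst.
rewrite RintegralD//; try by apply/continuous_integrable/continuousMfun => //; exact: pc.
rewrite -(@integral_strip G1 f1 ('D_(0, 1) phi) chi dpsi)//.
- rewrite -(@integral_strip G2 f2 ('D_(1, 0) phi) dchi psi)//.
  + rewrite f1A// f2B// -opprD -RintegralD; [|exact: measurable_strip|exact: integrable_mul_phi..].
    apply/eqP; rewrite oppr_eq0; apply/eqP.
    transitivity (\int[lebesgue_plane]_(x in strip m) (0 : R)); last first.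
      by rewrite /Rintegral integral0.
    congr fine; apply: ae_eq_integral.
    * exact: measurable_strip.
    * have /integrableP[/measurable_EFinP mA _] := integrable_mul_phi Al.
      have /integrableP[/measurable_EFinP mB _] := integrable_mul_phi Bl.
      exact/measurable_EFinP/measurable_funD.
    * exact: measurable_cst.
    move: AB; apply: filterS; first exact: (ae_filter_ringOfSetsType lebesgue_plane).
    by move=> x ABx xs; rewrite -mulrDl ABx// mul0r.
  + by move=> x; rewrite derive_phi /= mul1r mul0r addr0.
  + exact: dcutoff_supp chiP.
  + exact: cutoff_supp psiP.
- by move=> x; rewrite derive_phi /= mul1r mul0r add0r.
- exact: cutoff_supp chiP.
- exact: dcutoff_supp psiP.
Qed.

End plane.

End weak_equations.

(** * From the weak to the classical derivative *)

Section du_bois_reymond.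
Context {R : realType}.
Local Notation mu := (@lebesgue_measure R).
Variable m : R.
Hypothesis m0 : 0 < m.

Lemma continuous_at_within (f : R -> R) (a b : R) :
  (forall x, a <= x <= b -> {for x, continuous f}) -> {within `[a, b], continuous f}.
Proof.
move=> fc; apply: continuous_in_subspaceT => x; rewrite inE/= in_itv/=.
exact: fc.
Qed.

Lemma within_continuousM (f g : R -> R) (a b : R) : {within `[a, b], continuous f} ->
  {within `[a, b], continuous g} -> {within `[a, b], continuous (fun x => f x * g x)}.
Proof. by move=> fc gc x; apply: continuousM; [exact: fc|exact: gc]. Qed.

Lemma within_continuousD (f g : R -> R) (a b : R) : {within `[a, b], continuous f} ->
  {within `[a, b], continuous g} -> {within `[a, b], continuous (fun x => f x + g x)}.
Proof. by move=> fc gc x; apply: continuousD; [exact: fc|exact: gc]. Qed.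

Lemma within_continuousN (f : R -> R) (a b : R) : {within `[a, b], continuous f} ->
  {within `[a, b], continuous (fun x => - f x)}.
Proof. by move=> fc x; apply: continuousN; exact: fc. Qed.

(** The test functions are the differences of a step at [p] and of a step at
    [q]: their derivative is a positive bump near [p] and a negative bump near
    [q]. *)
Lemma weakly_constant_le (f : R -> R) : {within `[- m, 0], continuous f} ->
  (forall c d psi dpsi, is_cutoff c d psi dpsi -> - m < c -> c <= d -> d < 0 ->
     \int[mu]_(x in `[- m, 0]) (f x * dpsi x) = 0) ->
  forall p q, - m < p -> p < q -> q < 0 -> f q <= f p.
Proof.
move=> fc fw p q mp pq q0; rewrite leNgt; apply/negP => fpq.
(* If [f p < f q], then [(v - f) psi'] is nonnegative, with integral 0. *)
pose v := (f p + f q) / 2.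
have [pv vq] : f p < v /\ v < f q by rewrite /v; split; lra.
have fp : {for p, continuous f} by apply: (within_continuous_at fc); lra.
have fq : {for q, continuous f} by apply: (within_continuous_at fc); lra.
have /nbhs_ballP[r1 /= r10 r1P] : \forall x \near p, f x < v by apply: (cvgr_lt (f p) fp).
have /nbhs_ballP[r2 /= r20 r2P] : \forall x \near q, v < f x by apply: (cvgr_gt (f q) fq).
pose e := Num.min (Num.min r1 r2) (Num.min (q - p) (- q)) / 2.
have [e0 er1 er2 epq eq0] : [/\ 0 < e, e < r1, e < r2, e < q - p & e < - q].
  rewrite /e; set M := Num.min _ _.
  have M0 : 0 < M by rewrite !lt_min; lra.
  have : M <= r1 /\ M <= r2 /\ M <= q - p /\ M <= - q.
    by rewrite /M !ge_min !lexx ?orbT.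
  by case=> M1 [M2 [M3 M4]]; clearbody M; clear fp fq; split; lra.
have [S [s Ss]] := is_step_exists p e0; have [T [t Tt]] := is_step_exists q e0.
have psiP := step_cutoff Ss Tt (ltW pq) e0.
have c0 : continuous (fun x => s x - t x) := smooth_continuous (dcutoff_smooth psiP).
have dpsi0 : \int[mu]_(x in `[- m, 0]) (s x - t x) = 0.
  have psic := smooth_continuous (cutoff_smooth psiP).
  rewrite (FTC2_segment _ (continuous_subspaceT c0) (continuous_subspaceT psic)
    (fun x _ => cutoff_derive psiP x)); last lra.
  by rewrite !(cutoff_supp psiP) ?subrr//= in_itv/=; lra.
pose g x := v * (s x - t x) - f x * (s x - t x).
have fdc : {within `[- m, 0], continuous (fun x => f x * (s x - t x))}.
  by apply: within_continuousM => //; exact: continuous_subspaceT.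
have vdc : {within `[- m, 0], continuous (fun x => v * (s x - t x))}.
  by apply: within_continuousM; apply: continuous_subspaceT => //; exact: cst_continuous.
have gc : {within `[- m, 0], continuous g}.
  exact/(within_continuousD vdc)/within_continuousN.
have g0 x : - m <= x <= 0 -> 0 <= g x.
  move=> _; rewrite /g -mulrBl.
  have [xp|px] := leP x p.
    by rewrite (dstep_eq0 Ss) ?(dstep_eq0 Tt) ?subrr ?mulr0//; left => //; lra.
  have [xpe|pex] := leP x (p + e).
    rewrite (dstep_eq0 Tt) ?subr0; last by left; lra.
    rewrite mulr_ge0 ?(dstep_ge0 Ss)// subr_ge0 ltW// r1P//.
    by rewrite /ball/= ltr_distl; lra.
  rewrite (dstep_eq0 Ss) ?sub0r; last by right; lra.
  rewrite mulrN -mulNr opprB.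
  have [xq|qx] := leP x q; first by rewrite (dstep_eq0 Tt) ?mulr0//; left.
  have [xqe|qex] := leP x (q + e).
    rewrite mulr_ge0 ?(dstep_ge0 Tt)// subr_ge0 ltW// r2P//.
    by rewrite /ball/= ltr_distl; lra.
  by rewrite (dstep_eq0 Tt) ?mulr0//; right; exact: ltW.
have Ig : \int[mu]_(x in `[- m, 0]) g x <= 0.
  rewrite RintegralB//; try exact: within_integrable.
  rewrite RintegralZl//; last exact: continuous_integrable.
  have -> : \int[mu]_(x in `[- m, 0]) (f x * (s x - t x)) = 0.
    by apply: (fw _ _ _ _ psiP); lra.
  by rewrite dpsi0 mulr0 subrr.
have xI : - m < p + e / 2 < 0 by lra.
have := integral_segment_eq0 gc g0 Ig xI.
rewrite /g -mulrBl (dstep_eq0 Tt); last by left; lra.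
rewrite subr0; apply/eqP; rewrite mulf_neq0//; last first.
  by rewrite gt_eqF// (dstep_gt0 Ss)//; lra.
rewrite subr_eq0 gt_eqF// r1P//.
by rewrite /ball/= ltr_distl; lra.
Qed.

Variables (a b : R -> R).
Hypotheses (ac : continuous a) (bc : continuous b).
Hypothesis ab : forall c d psi dpsi, is_cutoff c d psi dpsi ->
  - m < c -> c <= d -> d < 0 ->
  \int[mu]_(x in `[- m, 0]) (a x * dpsi x + b x * psi x) = 0.

(** The du Bois-Reymond lemma. *)
Lemma weak_derivative_classical (p : R) : - m < p < 0 -> is_derive p (1 : R) a (b p).
Proof.
move=> p0.
(* A primitive of [b]; starting it below [- m] makes it differentiable at the
   ends of [[- m, 0]]. *)
pose B x := \int[mu]_(t in `[- m - 1, x]) b t.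
have dB (x : R) : - m <= x <= 0 -> is_derive x (1 : R) B (b x).
  move=> x0; apply: (@is_derive_integral _ b (- m - 1) 1).
  - exact: continuous_integrable.
  - lra.
  - exact: bc.
have Bc : {within `[- m, 0], continuous B}.
  by apply: continuous_at_within => x /dB; exact: is_derive1_continuous.
have mw := within_integrable.
have acw : {within `[- m, 0], continuous a} by exact: continuous_subspaceT.
have bcw : {within `[- m, 0], continuous b} by exact: continuous_subspaceT.
have aBc : {within `[- m, 0], continuous (fun x => a x - B x)}.
  exact/(within_continuousD acw)/within_continuousN.
have aB0 c d psi dpsi : is_cutoff c d psi dpsi -> - m < c -> c <= d -> d < 0 ->
    \int[mu]_(x in `[- m, 0]) ((a x - B x) * dpsi x) = 0.
  move=> psiP mc cd d0; have abpsi := ab psiP mc cd d0.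
  have psic : {within `[- m, 0], continuous psi}.
    exact/continuous_subspaceT/(smooth_continuous (cutoff_smooth psiP)).
  have dpsic : {within `[- m, 0], continuous dpsi}.
    exact/continuous_subspaceT/(smooth_continuous (dcutoff_smooth psiP)).
  have Bpsi : \int[mu]_(x in `[- m, 0]) (B x * dpsi x + b x * psi x) = 0.
    have dF x : - m < x < 0 -> is_derive x (1 : R) (fun x => B x * psi x)
        (B x * dpsi x + b x * psi x).
      move=> x0; have x0' : - m <= x <= 0 by lra.
      have := is_deriveM (dB x x0') (cutoff_derive psiP x).
      by move=> d1; apply: (is_derive_eq d1); rewrite /GRing.scale/= [psi x * _]mulrC.
    have fc : {within `[- m, 0], continuous (fun x => B x * dpsi x + b x * psi x)}.
      by apply: within_continuousD; exact: within_continuousM.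
    have m_lt0 : - m < 0 by lra.
    rewrite (FTC2_segment m_lt0 fc (within_continuousM Bc psic) dF).
    by rewrite !(cutoff_supp psiP) ?mulr0 ?subrr//= in_itv/=; lra.
  transitivity (\int[mu]_(x in `[- m, 0]) (a x * dpsi x + b x * psi x) -
                \int[mu]_(x in `[- m, 0]) (B x * dpsi x + b x * psi x)).
    rewrite -RintegralB//.
    - by apply: eq_Rintegral => x _; ring.
    - by apply: mw; apply: within_continuousD; exact: within_continuousM.
    - by apply: mw; apply: within_continuousD; exact: within_continuousM.
  by rewrite abpsi Bpsi subrr.
have cst_le := weakly_constant_le aBc aB0.
have Ncst_le := @weakly_constant_le (fun x => - (a x - B x)) _ _.
have cstE x : - m < x < 0 -> a x - B x = a p - B p.
  have key y z : - m < y < 0 -> - m < z < 0 -> y < z -> a y - B y = a z - B z.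
    move=> y0 z0 yz; apply/eqP; rewrite eq_le; apply/andP; split.
      rewrite -lerN2; apply: Ncst_le; [|  |lra..].
        exact: within_continuousN.
      move=> c d psi dpsi psiP mc cd d0.
      transitivity (- 1 * \int[mu]_(x in `[- m, 0]) ((a x - B x) * dpsi x)).
        rewrite -RintegralZl//; first by apply: eq_Rintegral => t _; ring.
        apply: mw; apply: within_continuousM => //.
        exact/continuous_subspaceT/(smooth_continuous (dcutoff_smooth psiP)).
      by rewrite (aB0 _ _ _ _ psiP) ?mulr0.
    by apply: cst_le; lra.
  move=> x0; have [xp|px|->//] := ltgtP x p; first exact: key.
  exact/esym/key.
have h : \forall x \near p, B x + (a p - B p) = a x.
  near=> x; rewrite -(cstE x); first ring.
  apply/andP; split; near: x; [apply: lt_nbhsr|apply: lt_nbhsl]; lra.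
apply: near_eq_is_derive h _.
have p0' : - m <= p <= 0 by lra.
have := is_deriveD (dB p p0') (is_derive_cst (a p - B p) p (1 : R)).
by move=> d1; apply: (is_derive_eq d1); rewrite addr0.
Unshelve. all: by end_near. Qed.

Lemma integral_primitive_parts (k : R -> R) : continuous k ->
  \int[mu]_(p in `[- m, 0]) (a p * k p + b p * \int[mu]_(x in `[- m, p]) k x) =
  a 0 * \int[mu]_(x in `[- m, 0]) k x.
Proof.
move=> kc; pose K p := \int[mu]_(x in `[- m, p]) k x.
have m_lt0 : - m < 0 by rewrite oppr_lt0.
have Kc : {within `[- m, 0], continuous K}.
  by apply: parameterized_integral_continuous; [exact: ltW|exact: continuous_integrable].
have aKc : {within `[- m, 0], continuous (fun x => a x * K x)}.
  by apply: within_continuousM => //; exact: continuous_subspaceT.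
have fc : {within `[- m, 0], continuous (fun x => a x * k x + b x * K x)}.
  apply: within_continuousD; apply: within_continuousM => //;
    exact: continuous_subspaceT.
have dF x : - m < x < 0 -> is_derive x (1 : R) (fun x => a x * K x)
    (a x * k x + b x * K x).
  move=> x0.
  have dK := is_derive_integral (continuous_integrable (- m) 0 kc) x0 (kc x).
  have := is_deriveM (weak_derivative_classical x0) dK.
  by move=> d1; apply: (is_derive_eq d1); rewrite /GRing.scale/= [K x * _]mulrC.
rewrite (FTC2_segment m_lt0 fc aKc dF).
by rewrite /K set_itv1 Rintegral_set1 mulr0 subr0.
Qed.

End du_bois_reymond.

(** * The integral identity *)

Section window.
Context {R : realType}.
Local Notation mu := (@lebesgue_measure R).

(** A cutoff [chi] equal to 1 on [[-L, L]], whose derivative has total variation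
    2 and lives in the region where [L <= |q|]. *)
Lemma window_exists (L : R) : 0 < L -> exists chi dchi : R -> R,
  [/\ is_cutoff (- L - 1) (L + 1) chi dchi,
    forall q, 0 <= chi q <= 1,
    forall q, `|q| <= L -> chi q = 1 &
    forall (f : R -> R) e, continuous f -> (forall q, L <= `|q| -> `|f q| <= e) ->
      `|\int[mu]_(q in `[- L - 1, L + 1]) (f q * dchi q)| <= e * 2].
Proof.
move=> L0; have [S [s Ss]] := is_step_exists (- L - 1) (ltr01 : 0 < (1 : R)).
have [T [t Tt]] := is_step_exists L (ltr01 : 0 < (1 : R)).
have LL : - L - 1 <= L by lra.
have chiP := step_cutoff Ss Tt LL ltr01.
exists (fun x => S x - T x), (fun x => s x - t x); split => //.
- move=> q; have [Lq|qL] := leP L q.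
    rewrite (step_eq1 Ss); last lra.
    by have := step_ge0 Tt q; have := step_le1 Tt q; lra.
  rewrite (step_eq0 Tt) ?subr0 ?(step_ge0 Ss) ?(step_le1 Ss)//.
  exact: ltW.
- move=> q; rewrite ler_norml => /andP[Lq qL].
  by rewrite (step_eq0 Tt)// (step_eq1 Ss) ?subr0//; lra.
- move=> f e fc fe.
  have sc := smooth_continuous (dstep_smooth Ss).
  have tc := smooth_continuous (dstep_smooth Tt).
  have <- : \int[mu]_(q in `[- L - 1, L + 1]) (s q + t q) = 2.
    rewrite RintegralD//; try exact: continuous_integrable.
    by rewrite (integral_dstep Ss) ?(integral_dstep Tt)//; lra.
  apply: normr_Rintegral_le_mul.
  + apply: continuousMfun => //; exact: smooth_continuous (dcutoff_smooth chiP).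
  + by move=> x; apply: cvgD; [exact: sc|exact: tc].
  move=> x _; have sx := dstep_ge0 Ss x; have tx := dstep_ge0 Tt x.
  have [Lx|xL] := leP L `|x|.
    rewrite normrM; apply: ler_pM => //; first exact: fe.
    by rewrite (le_trans (ler_normB _ _))// !ger0_norm.
  move: xL; rewrite ltr_norml => /andP[Lx xL].
  rewrite (dstep_eq0 Ss); last by right; lra.
  by rewrite (dstep_eq0 Tt) ?subrr ?addr0 ?mulr0 ?normr0//; left; exact: ltW.
Qed.

End window.

Section flux.
Context {R : realType}.
Local Notation mu := (@lebesgue_measure R).
Variables (m g sigma c0 : R) (k l : R * R -> R) (K eta S : R -> R).
Variables (f1 f2 A B : R * R -> R).

(** The flux in the direction of [p] of the height equation, where [k] and [l]
    stand for [hp] and [hq], and [K] for [Hp]. *)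
Definition flux1 (x : R * R) : R := - ((1 + l x ^+ 2) / (2 * k x ^+ 2)) + 1 / (2 * K x.2 ^+ 2).
(** The flux in the direction of [q]. *)
Definition flux2 (x : R * R) : R := l x / k x.
(** The part of [flux1 * K^3] that is not linear in [k - K], up to a sign. *)
Definition flux_remainder (x : R * R) : R :=
  ((k x - K x.2) ^+ 2 * (K x.2 + 2 * k x) + l x ^+ 2 * K x.2 ^+ 3) / (2 * k x ^+ 2).
(** The function whose weak derivative is the curvature of the surface. *)
Definition curvature_flux (q : R) : R := l (q, 0) / Num.sqrt (1 + l (q, 0) ^+ 2).

Hypotheses (m0 : 0 < m) (c00 : 0 < c0).
Hypotheses (kc : continuous k) (lc : continuous l) (Kc : continuous K).
Hypotheses (kc0 : forall x, c0 <= k x) (K0 : forall p, 0 < K p).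
Hypothesis etaE : forall q, eta q = \int[mu]_(p in `[- m, 0]) (k (q, p) - K p).
Hypothesis f1E : forall x, strip m x -> f1 x = flux1 x.
Hypothesis f2E : forall x, strip m x -> f2 x = flux2 x.
Hypothesis f1A : weak_derivative_plane (strip m) (0, 1) f1 A.
Hypothesis f2B : weak_derivative_plane (strip m) (1, 0) f2 B.
Hypothesis AB : {ae lebesgue_plane, forall x, strip m x -> A x + B x = 0}.
Hypothesis kS : weak_derivative_line setT curvature_flux S.
Hypothesis ES : {ae mu, forall q, - flux1 (q, 0) + g * eta q - sigma * S q = 0}.

Local Notation Phi p := (\int[mu]_(x in `[- m, p]) (K x ^+ 3)).

Let k0 x : 0 < k x. Proof. exact: lt_le_trans (kc0 x). Qed.

Let K2c : continuous (fun x : R * R => K x.2). Proof. exact: continuous_snd. Qed.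

Let contX (T : topologicalType) (f : T -> R) n : continuous f -> continuous (fun x => f x ^+ n).
Proof.
move=> fc x; apply: (cvg_comp f (fun y => y ^+ n)); first exact: fc.
exact: exprn_continuous.
Qed.

Let contV (T : topologicalType) (f : T -> R) : (forall x, 0 < f x) ->
  continuous f -> continuous (fun x => (f x)^-1).
Proof. by move=> f0 fc x; apply: cvgV; [rewrite gt_eqF|exact: fc]. Qed.

Let contD (T : topologicalType) (f h : T -> R) : continuous f -> continuous h ->
  continuous (fun x => f x + h x).
Proof. by move=> fc hc x; apply: cvgD; [exact: fc|exact: hc]. Qed.

Let contN (T : topologicalType) (f : T -> R) : continuous f ->
  continuous (fun x => - f x).
Proof. by move=> fc x; apply: cvgN; exact: fc. Qed.

Let contC (T : topologicalType) (c : R) : continuous (fun _ : T => c).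
Proof. exact: cst_continuous. Qed.

Let flux1_c : continuous flux1.
Proof.
apply: contD; [apply: contN|]; apply: continuousMfun.
- by apply: contD => //; exact: contX.
- apply: contV; last by apply: continuousMfun => //; exact: contX.
  by move=> x; rewrite mulr_gt0// exprn_gt0.
- by [].
- apply: contV; last by apply: continuousMfun => //; exact: contX.
  by move=> x; rewrite mulr_gt0// exprn_gt0.
Qed.

Let flux2_c : continuous flux2.
Proof. by apply: continuousMfun => //; exact: contV. Qed.

Let flux_remainder_c : continuous flux_remainder.
Proof.
apply: continuousMfun.
  apply: contD; apply: continuousMfun; try exact: contX.
    by apply: contX; apply: contD => //; exact: contN.
  by apply: contD => //; exact: continuousMfun.
apply: contV; last by apply: continuousMfun => //; exact: contX.
by move=> x; rewrite mulr_gt0// exprn_gt0.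
Qed.

Let flux_remainder_ge0 x : 0 <= flux_remainder x.
Proof.
have kx := k0 x; have Kx := K0 x.2.
apply: divr_ge0; last by rewrite mulr_ge0// sqr_ge0.
apply: addr_ge0; apply: mulr_ge0; rewrite ?sqr_ge0//.
  by rewrite addr_ge0 ?mulr_ge0// ltW.
by rewrite exprn_ge0// ltW.
Qed.

Let curvature_flux_c : continuous curvature_flux.
Proof.
have l0 : continuous (fun q => l (q, 0)) by exact: continuous_slice1.
apply: continuousMfun => //; apply: contV.
  by move=> q; rewrite sqrtr_gt0 ltr_wpDr// sqr_ge0.
have c1 : continuous (fun q => 1 + l (q, 0) ^+ 2).
  by apply: contD => //; exact: contX.
move=> q; apply: (cvg_comp (fun q => 1 + l (q, 0) ^+ 2) Num.sqrt); first exact: c1.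
exact: sqrt_continuous.
Qed.

(** The first flux is linear up to a signed remainder. *)
Lemma flux1_remainder x : flux1 x * K x.2 ^+ 3 = (k x - K x.2) - flux_remainder x.
Proof.
rewrite /flux1 /flux_remainder; field.
by rewrite !gt_eqF.
Qed.

Let eta_c : continuous eta.
Proof.
have -> : eta = (fun q => \int[mu]_(p in `[- m, 0]) (k (q, p) - K p)).
  by apply/funext => q; rewrite etaE.
apply: (@continuous_parametric _ (fun x => k (x.2, x.1) - K x.1)); apply: contD; last first.
  by apply: contN; exact: continuous_fst.
move=> x; apply: (cvg_comp (fun x : R * R => (x.2, x.1)) k); last exact: kc.
by apply: (@cvg_pair _ _ _ _ (nbhs x.2) (nbhs x.1)); [exact: cvg_snd|exact: cvg_fst].
Qed.

Section cutoff.
Variables (a b : R) (chi dchi : R -> R).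
Hypothesis chiP : is_cutoff a b chi dchi.

Let chi_c : continuous chi := smooth_continuous (cutoff_smooth chiP).
Let dchi_c : continuous dchi := smooth_continuous (dcutoff_smooth chiP).

Let parc (G : R * R -> R) (u : R -> R) : continuous G -> continuous u ->
  continuous (fun p => \int[mu]_(q in `[a, b]) (G (q, p) * u q)).
Proof.
move=> Gc uc; apply: (@continuous_parametric _ (fun x => G x * u x.1)).
by apply: continuousMfun => //; exact: continuous_fst.
Qed.

Let sli (G : R * R -> R) (u : R -> R) p : continuous G -> continuous u ->
  mu.-integrable `[a, b] (EFin \o (fun q => G (q, p) * u q)).
Proof.
move=> Gc uc; apply: continuous_integrable; apply: continuousMfun => //.
exact: continuous_slice1.
Qed.

(** The integral over [q] of [flux1 chi], as a function of [p], has the one of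
    [flux2 chi'] for derivative; the identity follows by integrating by parts
    against the primitive of [K^3] that vanishes at the bottom, whose boundary
    term at [p = 0] is given by the surface equation. *)
Lemma flux_identity :
  \int[mu]_(p in `[- m, 0]) \int[mu]_(q in `[a, b]) (flux_remainder (q, p) * chi q) =
    (1 - g * Phi 0) * \int[mu]_(q in `[a, b]) (eta q * chi q)
    + \int[mu]_(p in `[- m, 0])
        ((\int[mu]_(q in `[a, b]) (flux2 (q, p) * dchi q)) * Phi p)
    - sigma * Phi 0 * \int[mu]_(q in `[a, b]) (curvature_flux q * dchi q).
Proof.
have K3c : continuous (fun p => K p ^+ 3) by exact: contX.
have surf := surface_equation_cutoff chiP kS.
have main := @integral_primitive_parts _ m m0
  (fun p => \int[mu]_(q in `[a, b]) (flux1 (q, p) * chi q))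
  (fun p => \int[mu]_(q in `[a, b]) (flux2 (q, p) * dchi q))
  (parc flux1_c chi_c) (parc flux2_c dchi_c) _ _ K3c.
have {}main := main (fun c d psi dpsi psiP mc cd d0 =>
  interior_equation_cutoff chiP psiP mc d0 flux1_c flux2_c f1E f2E f1A f2B AB).
have {}surf : - (\int[mu]_(q in `[a, b]) (flux1 (q, 0) * chi q))
    + g * \int[mu]_(q in `[a, b]) (eta q * chi q) =
    - sigma * \int[mu]_(q in `[a, b]) (curvature_flux q * dchi q).
  rewrite -(surf sigma (fun q => - flux1 (q, 0) + g * eta q))//; last first.
    apply: contD; first by apply: contN; exact: continuous_slice1.
    by apply: continuousMfun.
  rewrite -mulN1r -!RintegralZl//; [|exact: sli|exact/continuous_integrable/continuousMfun].
  rewrite -RintegralD//.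
  - by apply: eq_Rintegral => q _; ring.
  - apply/continuous_integrable/continuousMfun => //; apply: continuousMfun => //.
    exact: continuous_slice1.
  - by apply: continuous_integrable; apply: continuousMfun => //; apply: continuousMfun.
have etachi : \int[mu]_(q in `[a, b]) (eta q * chi q) =
    \int[mu]_(p in `[- m, 0]) \int[mu]_(q in `[a, b]) ((k (q, p) - K p) * chi q).
  have wc : continuous (fun x : R * R => (k x - K x.2) * chi x.1).
    by apply: continuousMfun; [apply: contD => //; exact: contN|exact: continuous_fst].
  rewrite -((fubini_rect a b (- m) 0 wc).1) (fubini_rect a b (- m) 0 wc).2.
  apply: eq_Rintegral => q _; rewrite etaE -RintegralZr//=.
  apply: continuous_integrable; apply: contD; first exact: continuous_slice2.
  exact: contN.
have inner p : (\int[mu]_(q in `[a, b]) (flux1 (q, p) * chi q)) * K p ^+ 3 =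
    \int[mu]_(q in `[a, b]) ((k (q, p) - K p) * chi q) -
    \int[mu]_(q in `[a, b]) (flux_remainder (q, p) * chi q).
  rewrite -RintegralZr//; last exact: sli.
  rewrite -RintegralB//; last exact: sli.
    by apply: eq_Rintegral => q _; rewrite -mulrBl -(flux1_remainder (q, p)) /= mulrAC.
  by apply: (@sli (fun x => k x - K x.2)) => //; apply: contD => //; exact: contN.
have Phic : {within `[- m, 0], continuous (fun p => Phi p)}.
  apply: parameterized_integral_continuous; last exact: continuous_integrable.
  by rewrite lerNl oppr0 ltW.
move: main; rewrite RintegralD//; first last.
- apply: within_integrable; apply: within_continuousM => //.
  exact/continuous_subspaceT/parc.
- by apply/continuous_integrable/continuousMfun => //; exact: parc.
under eq_Rintegral do rewrite inner.
rewrite RintegralB//; first last.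
- exact/continuous_integrable/parc.
- apply: continuous_integrable; apply: (@parc (fun x => k x - K x.2)) => //.
  by apply: contD => //; exact: contN.
rewrite -etachi => main.
have lin (a0 X J T1 T2 P : R) : - a0 + g * X = - sigma * T2 ->
    X - J + T1 = a0 * P -> J = (1 - g * P) * X + T1 - sigma * P * T2.
  move=> e1 e2; have -> : J = X + T1 - (X - J + T1) by ring.
  have -> : X - J + T1 = (g * X - (- a0 + g * X)) * P by rewrite e2; ring.
  by rewrite e1; ring.
exact: lin surf main.
Qed.

End cutoff.
Hypothesis l_tail : forall e, 0 < e -> exists L0, forall q p,
  L0 <= `|q| -> - m <= p <= 0 -> `|l (q, p)| <= e.

Let Phi_ge0 p : 0 <= Phi p.
Proof. by apply: Rintegral_ge0 => x _; rewrite exprn_ge0// ltW. Qed.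

Let Phi_le p : p <= 0 -> Phi p <= Phi 0.
Proof.
move=> p0; rewrite /Rintegral.
have K3c : continuous (fun p => K p ^+ 3) by exact: contX.
have K3i := continuous_integrable (- m) 0 K3c.
apply: fine_le.
- by apply: integrable_fin_num => //; exact: continuous_integrable.
- exact: integrable_fin_num.
- apply: ge0_subset_integral => //.
  + by case/integrableP : K3i.
  + by move=> x _; rewrite lee_fin exprn_ge0// ltW.
  + by apply: subset_itvl; rewrite bnd_simp.
Qed.

(** If the sign of [(1 - g Phi(0)) eta] makes the main term of the identity
    nonpositive, then the remainder vanishes. *)
Lemma flux_remainder_eq0 : (forall q, (1 - g * Phi 0) * eta q <= 0) ->
  forall q p, - m < p < 0 -> flux_remainder (q, p) = 0.
Proof.
move=> sgn q0 p0 p0m.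
pose L1 := `|q0| + 1.
have L10 : 0 < L1 by rewrite ltr_wpDl.
have [chi1 [dchi1 [chi1P chi1_01 chi1_1 _]]] := window_exists L10.
pose n1 p := \int[mu]_(q in `[- L1 - 1, L1 + 1]) (flux_remainder (q, p) * chi1 q).
have chi1_c := smooth_continuous (cutoff_smooth chi1P).
have parc (a b : R) (G : R * R -> R) (u : R -> R) : continuous G -> continuous u ->
    continuous (fun p => \int[mu]_(q in `[a, b]) (G (q, p) * u q)).
  move=> Gc uc; apply: (@continuous_parametric _ (fun x => G x * u x.1)).
  by apply: continuousMfun => //; exact: continuous_fst.
have n1c : continuous n1 by exact: parc.
have Nchi_c (chi : R -> R) p : continuous chi ->
    continuous (fun q => flux_remainder (q, p) * chi q).
  by move=> chic; apply: continuousMfun => //; exact: continuous_slice1.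
have n1_ge0 p : 0 <= n1 p.
  apply: Rintegral_ge0 => q _; rewrite mulr_ge0//.
  by have /andP[] := chi1_01 q.
have n1_le : \int[mu]_(p in `[- m, 0]) n1 p <= 0.
  apply/ler_addgt0Pl => e e0; rewrite addr0.
  (* [C e'] dominates the last two terms of the identity when [|l| <= e'] on the
     support of the derivative of the cutoff; the last 1 ensures [0 < C]. *)
  pose C := m * (2 / c0 * Phi 0) + 2 * `|sigma| * Phi 0 + 1.
  have C0 : 0 < C.
    have h1 : 0 <= 2 / c0 by apply: divr_ge0 => //; exact: ltW.
    have h2 : 0 <= m * (2 / c0 * Phi 0).
      by apply: mulr_ge0; [exact: ltW|exact: mulr_ge0].
    have h3 : 0 <= 2 * `|sigma| * Phi 0 by apply: mulr_ge0 => //; exact: mulr_ge0.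
    by rewrite /C ltr_wpDl// addr_ge0.
  have eC0 : 0 < e / C by rewrite divr_gt0.
  have [L0 L0P] := l_tail eC0.
  (* On [[- L1 - 1, L1 + 1]], the support of [chi1], the wider cutoff is 1. *)
  pose L := Num.max (L1 + 1) L0.
  have LL1 : L1 + 1 <= L by rewrite le_max lexx.
  have L_gt0 : 0 < L by rewrite (lt_le_trans _ LL1)// addr_gt0.
  have LL0 : L0 <= L by rewrite le_max lexx orbT.
  have [chi [dchi [chiP chi_01 chi_1 dchiP]]] := window_exists L_gt0.
  have chi_c := smooth_continuous (cutoff_smooth chiP).
  pose n p := \int[mu]_(q in `[- L - 1, L + 1]) (flux_remainder (q, p) * chi q).
  have nc : continuous n by exact: parc.
  have n1n p : n1 p <= n p.
    rewrite /n1 (@Rintegral_supp _ _ _ mu _ _ `[- L - 1, L + 1]%classic).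
    - apply: le_Rintegral => //; try exact/continuous_integrable/Nchi_c.
      move=> q _; apply: ler_wpM2l => //.
      have /andP[c1 c2] := chi1_01 q; have /andP[c3 c4] := chi_01 q.
      have [qL|Lq] := leP `|q| L; first by rewrite (chi_1 q qL).
      rewrite (cutoff_supp chi1P)//= in_itv/= => /andP[h1 h2].
      by move: Lq; rewrite ltNge ler_norml => /negP; apply; lra.
    - by move=> q /=; rewrite !in_itv/= => /andP[h1 h2] []; lra.
    - by move=> q _ hq; rewrite (cutoff_supp chi1P)// mulr0.
  have lL q p : L <= `|q| -> - m <= p <= 0 -> `|l (q, p)| <= e / C.
    by move=> Lq; apply: L0P; exact: le_trans Lq.
  pose b p := \int[mu]_(q in `[- L - 1, L + 1]) (flux2 (q, p) * dchi q).
  have dchi_c := smooth_continuous (dcutoff_smooth chiP).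
  have bc : continuous b by exact: parc.
  have b_le p : - m <= p <= 0 -> `|b p| <= e / C / c0 * 2.
    move=> pm; apply: (dchiP (fun q => flux2 (q, p))); first exact: continuous_slice1.
    move=> q Lq; rewrite normrM normfV ler_pM ?invr_ge0 ?normr_ge0//.
      exact: lL.
    by rewrite gtr0_norm// lef_pV2// posrE.
  have kap_le : `|\int[mu]_(q in `[- L - 1, L + 1]) (curvature_flux q * dchi q)| <= e / C * 2.
    apply: dchiP => // q Lq; rewrite normrM normfV ler_pdivrMr; last first.
      by rewrite normr_gt0 gt_eqF// sqrtr_gt0 ltr_wpDr// sqr_ge0.
    have lq : `|l (q, 0)| <= e / C by apply: lL => //; rewrite oppr_le0 lexx ltW.
    apply: (le_trans lq).
    have s1 : 1 <= Num.sqrt (1 + l (q, 0) ^+ 2).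
      by rewrite -[leLHS]sqrtr1 ler_wsqrtr// lerDl sqr_ge0.
    apply: ler_peMr; first exact: ltW.
    by rewrite ger0_norm ?sqrtr_ge0.
  have Phic : {within `[- m, 0], continuous (fun p => Phi p)}.
    apply: parameterized_integral_continuous; last exact/continuous_integrable/contX.
    by rewrite lerNl oppr0 ltW.
  have bPhi_c : {within `[- m, 0], continuous (fun p => b p * Phi p)}.
    by apply: within_continuousM => //; exact: continuous_subspaceT.
  have bPhi_le : `|\int[mu]_(p in `[- m, 0]) (b p * Phi p)| <= (e / C / c0 * 2 * Phi 0) * m.
    apply: le_trans (le_normr_Rintegral _ (within_integrable bPhi_c)) _ => //.
    have -> : (e / C / c0 * 2 * Phi 0) * m = \int[mu]_(p in `[- m, 0]) (e / C / c0 * 2 * Phi 0).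
      have mum : mu `[- m, 0]%classic = m%:E.
        by rewrite lebesgue_measure_itv/= lte_fin oppr_lt0 m0 -EFinB sub0r opprK.
      by rewrite Rintegral_cst//; congr (_ * _); exact/esym/(congr1 fine mum).
    apply: le_Rintegral => //.
    - exact/integrable_norm/within_integrable.
    - exact/continuous_integrable/cst_continuous.
    move=> p; rewrite /= in_itv/= => pm; rewrite normrM ler_pM//; first exact: b_le.
    by rewrite ger0_norm// Phi_le//; case/andP: pm.
  have main_le : (1 - g * Phi 0) * \int[mu]_(q in `[- L - 1, L + 1]) (eta q * chi q) <= 0.
    move: (1 - g * Phi 0) sgn => c c_sgn.
    rewrite -RintegralZl//; last exact/continuous_integrable/continuousMfun.
    apply: (@le_trans _ _ (\int[mu]_(q in `[- L - 1, L + 1]) (0 : R))); last first.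
      by rewrite Rintegral_cst// mul0r.
    apply: le_Rintegral => //.
    - by apply/continuous_integrable/continuousMfun => //; exact: continuousMfun.
    - exact/continuous_integrable/cst_continuous.
    move=> q _; rewrite mulrA.
    by apply: mulr_le0_ge0 => //; have /andP[] := chi_01 q.
  have id := flux_identity chiP.
  have le1 : \int[mu]_(p in `[- m, 0]) n1 p <= \int[mu]_(p in `[- m, 0]) n p.
    by apply: le_Rintegral => //; exact: continuous_integrable.
  apply: (le_trans le1); rewrite /n id -/(b _).
  have -> : e = 0 + (e / C / c0 * 2 * Phi 0) * m + (`|sigma| * Phi 0 * (e / C * 2) + e / C).
    rewrite [LHS](_ : _ = e / C * C); first by rewrite /C; ring.
    by rewrite divfK// gt_eqF.
  apply: lerD; first by apply: lerD => //; exact: le_trans (ler_norm _) bPhi_le.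
  rewrite ler_wpDr ?(ltW eC0)// (le_trans (ler_norm _))// normrN !normrM.
  rewrite [`|Phi 0|]ger0_norm//.
  by apply: ler_wpM2l => //; rewrite mulr_ge0.
have n10 : n1 p0 = 0.
  exact: (integral_segment_eq0 (continuous_subspaceT n1c) (fun x _ => n1_ge0 x) n1_le p0m).
have q0L : - L1 - 1 < q0 < L1 + 1.
  have /andP[h1 h2] : - `|q0| <= q0 <= `|q0| by rewrite -ler_norml.
  by rewrite /L1; lra.
have := integral_segment_eq0 (continuous_subspaceT (Nchi_c _ p0 chi1_c)) _ _ q0L.
rewrite chi1_1 ?mulr1; last by rewrite /L1 lerDl.
apply; last by rewrite -[X in X <= _]/(n1 p0) n10.
by move=> q _; rewrite mulr_ge0//; have /andP[] := chi1_01 q.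
Qed.

Lemma height_derivatives_eq : (forall q, (1 - g * Phi 0) * eta q <= 0) ->
  forall q p, - m < p < 0 -> k (q, p) = K p.
Proof.
move=> sgn q p pm; have := flux_remainder_eq0 sgn q pm.
have kx := k0 (q, p); have Kx := K0 p.
rewrite /flux_remainder /= => /eqP; rewrite mulf_eq0 invr_eq0 mulf_eq0 pnatr_eq0/=.
rewrite sqrf_eq0 [k _ == 0]gt_eqF// orbF paddr_eq0; first last.
- by rewrite mulr_ge0 ?sqr_ge0// exprn_ge0// ltW.
- by rewrite mulr_ge0 ?sqr_ge0// addr_ge0 ?mulr_ge0// ltW.
move=> /andP[+ _]; rewrite mulf_eq0 sqrf_eq0 => /orP[|].
  by rewrite subr_eq0 => /eqP.
by rewrite gt_eqF// addr_gt0// mulr_gt0.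
Qed.

End flux.

(** * Extension of the height derivatives to the plane *)

Section clamp.
Context {R : realType}.
Variable m : R.
Hypothesis m0 : 0 < m.

(** The point of [[- m, 0]] nearest to [p]. *)
Definition clamp (p : R) : R := Num.max (- m) (Num.min p 0).

Lemma clamp_itv p : - m <= clamp p <= 0.
Proof. by rewrite /clamp le_max lexx/= ge_max oppr_le0 ltW//= ge_min lexx orbT. Qed.

Lemma clamp_id p : - m <= p <= 0 -> clamp p = p.
Proof. by move=> /andP[mp p0]; rewrite /clamp (min_idPl p0) (max_idPr mp). Qed.

Lemma clamp_continuous : continuous clamp.
Proof.
move=> p; apply: (@continuous_max R R (cst (- m)) (fun p => Num.min p 0)).
  exact: cst_continuous.
apply: (@continuous_min R R id (cst 0)); last exact: cst_continuous.
exact: cvg_id.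
Qed.

Lemma continuous_comp_within (T U : topologicalType) (A : set U) (f : U -> R)
    (c : T -> U) : {within A, continuous f} -> continuous c -> (forall x, A (c x)) ->
  continuous (f \o c).
Proof.
move=> fc cc cA x W /(fc (c x)); rewrite /nbhs/= -nbhs_subspace_in// => fW.
apply: (@filterS _ (nbhs x) _ _ _ _ (cc x _ fW)) => y /= h; exact: h (cA y).
Qed.

Lemma holder_continuous_clamp (alpha : R) (f : R * R -> R) : 0 < alpha ->
  holder_loc alpha (closed_strip m) f -> continuous (fun x => f (x.1, clamp x.2)).
Proof.
move=> alpha0 fh x0.
pose D := rect (x0.1 - 1) (x0.1 + 1) (- m) 0.
have [|C HC] := fh D (@compact_rect _ _ _ _ _).
  by move=> x [_ /=]; rewrite in_itv.
pose c (x : R * R) := (x.1, clamp x.2).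
have cc : continuous c.
  move=> x; apply: (@cvg_pair _ _ _ _ (nbhs x.1) (nbhs (clamp x.2))); first exact: cvg_fst.
  by apply: (cvg_comp snd clamp); [exact: cvg_snd|exact: clamp_continuous].
have fstc : continuous (fst : R * R -> R) by move=> y; exact: cvg_fst.
have C1 : 0 < `|C| + 1 by rewrite ltr_wpDl.
apply/cvgrPdist_le => e e0.
(* Points of [D] at distance at most [r] have images at distance at most [e]. *)
pose r := (e / (`|C| + 1)) `^ alpha^-1.
have r0 : 0 < r by rewrite powR_gt0// divr_gt0.
have n1 : \forall x \near x0, `|x0.1 - x.1| <= 1.
  by have /cvgrPdist_le := fstc x0; apply.
have n2 : \forall x \near x0, `|c x0 - c x| <= r.
  by have /cvgrPdist_le := cc x0; apply.
near=> x.
have xD y : `|x0.1 - y.1| <= 1 -> D (c y).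
  rewrite ler_distl => h; split; rewrite /= in_itv/=; last exact: clamp_itv.
  by lra.
have D0 : D (c x0) by apply: xD; rewrite subrr normr0.
have Dx : D (c x).
  by apply: xD; near: x; exact: n1.
apply: (le_trans (HC _ _ D0 Dx)).
have cx : `|c x0 - c x| <= r by near: x; exact: n2.
have rE : r `^ alpha = e / (`|C| + 1).
  by rewrite /r -powRrM mulVf ?gt_eqF// powRr1// divr_ge0// ltW.
have cxr : `|c x0 - c x| `^ alpha <= e / (`|C| + 1).
  by rewrite -rE ge0_ler_powR// ?nnegrE ?powR_ge0// ltW.
apply: (@le_trans _ _ ((`|C| + 1) * (e / (`|C| + 1)))); last first.
  by rewrite mulrC divfK// gt_eqF.
apply: (@le_trans _ _ (`|C| * `|c x0 - c x| `^ alpha)).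
  by rewrite ler_wpM2r ?powR_ge0// ler_norm.
by apply: ler_pM => //; rewrite ?powR_ge0// lerDl.
Unshelve. all: by end_near. Qed.

Lemma inf_pos_le (T : Type) (f : T -> R) (A : set T) x : 0 < inf (f @` A) -> A x ->
  inf (f @` A) <= f x.
Proof.
move=> i0 Ax; apply: ge_inf; last by exists x.
have [[]//|noinf] := pselect (has_inf (f @` A)).
by move: i0; rewrite inf_out// ltxx.
Qed.

Lemma uniform_tail (u : R -> R -> R) (A : set R) :
  {uniform A, u @ +oo --> (fun=> 0 : R)} -> {uniform A, u @ -oo --> (fun=> 0 : R)} ->
  forall e, 0 < e -> exists L0, forall q p, L0 <= `|q| -> A p -> `|u q p| <= e.
Proof.
move=> up un e e0.
pose W : set {uniform` A -> R} := [set v | forall p, A p -> `|v p| <= e].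
have WP : nbhs ((fun=> 0) : {uniform` A -> R}) W.
  apply/uniform_nbhs; exists [set xy | ball xy.1 e xy.2]; split.
    exact: (entourage_ball _ (PosNum e0)).
  by move=> v /= vP p /vP; rewrite /ball/= sub0r normrN => /ltW.
have [M1 [_ M1P]] := up _ WP.
have [M2 [_ M2P]] := un _ WP.
exists (Num.max M1 (- M2) + 1) => q p Lq Ap.
have [q0|q0] := leP 0 q.
  apply: M1P => //; move: Lq; rewrite ger0_norm//; apply: lt_le_trans.
  by rewrite ltr_pwDr// le_max lexx.
apply: M2P => //; move: Lq; rewrite ltr0_norm// => Lq.
rewrite -ltrN2; apply: lt_le_trans Lq.
by rewrite ltr_pwDr// le_max lexx orbT.
Qed.

End clamp.

(** * Solitary waves *)

Section rigidity.
Context {R : realType}.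
Local Notation mu := (@lebesgue_measure R).
Variables (g d m sigma alpha : R) (h hq hp : R * R -> R) (H Hp : R -> R).
Hypotheses (m0 : 0 < m) (alpha01 : 0 < alpha < 1).
Hypothesis hreg : wave_regularity m alpha h hq hp H Hp.
Hypothesis hwave : solitary_wave g d m sigma h hq hp H Hp.

(* Continuous extensions to the plane of [hp], [hq], [Hp] and [h - H]. *)
Let k (x : R * R) := hp (x.1, clamp m x.2).
Let l (x : R * R) := hq (x.1, clamp m x.2).
Let K p := Hp (clamp m p).
Let hK q p := h (q, clamp m p) - H (clamp m p).

Let clamp_cstrip q p : closed_strip m (q, clamp m p).
Proof. exact: clamp_itv. Qed.

Let clampE p : - m < p < 0 -> clamp m p = p.
Proof. by move=> /andP[mp p0]; rewrite clamp_id// !ltW. Qed.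

Let Kc : continuous K.
Proof.
apply: (continuous_comp_within (Hp_continuous hreg) (@clamp_continuous _ m)) => p.
by rewrite /= in_itv/=; exact: clamp_itv.
Qed.

Let hK_c q : continuous (hK q).
Proof.
have c1 : continuous (h \o (fun p => (q, clamp m p))).
  apply: (continuous_comp_within (h_continuous hreg)) => [p|p]; last exact: clamp_cstrip.
  apply: (@cvg_pair _ _ _ _ (nbhs q) (nbhs (clamp m p))); first exact: cvg_cst.
  exact: clamp_continuous.
have c2 : continuous (H \o clamp m).
  apply: (continuous_comp_within (H_continuous hreg) (@clamp_continuous _ m)) => p.
  by rewrite /= in_itv/=; exact: clamp_itv.
by move=> p; apply: cvgB; [exact: c1|exact: c2].
Qed.

Let hK_derive q p : - m < p < 0 -> is_derive p (1 : R) (hK q) (hp (q, p) - Hp p).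
Proof.
move=> pm; have [_ dh] := h_derive hreg (pm : strip m (q, p)).
have dH := H_derive hreg pm.
have E : \forall x \near p, h (q, x) - H x = hK q x.
  near=> x; rewrite /hK clampE//.
  by apply/andP; split; near: x; [apply: lt_nbhsr|apply: lt_nbhsl]; case/andP: pm.
apply: near_eq_is_derive E _; apply: is_deriveB dH.
have A (t v x : R) : (q, t *: v + x) = t *: (0, v) + (q, x) :> R * R.
  by rewrite -[RHS]/(t *: (0 : R) + q, t *: v + x) scaler0 add0r.
exact: (@is_derive_comp_affine _ R (R * R)%type (fun x => (q, x)) (fun v => (0, v))).
Unshelve. all: by end_near. Qed.

Let hK_bottom q : hK q (- m) = 0.
Proof.
rewrite /hK clamp_id ?lexx ?oppr_le0 ?ltW//.
by rewrite (bottom_condition hwave) (H_bottom hwave) subrr.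
Qed.

(** A sign condition on the main term of the integral identity forces the wave
    to be trivial. *)
Lemma wave_trivial :
  (forall q, (1 - g * \int[mu]_(p in `[- m, 0]) (Hp p ^+ 3)) * elevation h H q <= 0) ->
  forall x, closed_strip m x -> h x = H x.2.
Proof.
move=> sgn; have /andP[alpha0 _] := alpha01.
have mle : - m <= 0 by rewrite oppr_le0 ltW.
have kc : continuous k by apply: holder_continuous_clamp (hp_holder hreg).
have lc : continuous l by apply: holder_continuous_clamp (hq_holder hreg).
have K0 p : 0 < K p.
  apply: lt_le_trans (min_Hp_gt0 hwave) _.
  apply: (inf_pos_le (min_Hp_gt0 hwave)).
  by rewrite /= in_itv/=; exact: clamp_itv.
have kc0 x : inf (hp @` closed_strip m) <= k x.
  by apply: (inf_pos_le (inf_hp_gt0 hwave)); exact: clamp_cstrip.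
have stripE x : strip m x -> (x.1, clamp m x.2) = x.
  by move=> xs; rewrite clampE//; case: x xs.
have clamp0 : clamp m 0 = 0 by rewrite clamp_id// mle lexx.
have etaE q : elevation h H q = \int[mu]_(p in `[- m, 0]) (k (q, p) - K p).
  have dhK p : - m < p < 0 -> is_derive p (1 : R) (hK q) (k (q, p) - K p).
    by move=> pm; have := hK_derive q pm; rewrite /k /K /= clampE.
  have kKc : continuous (fun p => k (q, p) - K p).
    by move=> p; apply: cvgB; [exact: continuous_slice2|exact: Kc].
  have m_lt0 : - m < 0 by rewrite oppr_lt0.
  rewrite (FTC2_segment m_lt0 (continuous_subspaceT kKc)
    (continuous_subspaceT (@hK_c q)) dhK).
  by rewrite hK_bottom subr0 /hK clamp0.
have [A [B [f1A f2B AB]]] := interior_equation hwave.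
have [S [kS ES]] := surface_equation hwave.
have kS' : weak_derivative_line setT (curvature_flux l) S.
  have -> // : curvature_flux l = (fun q => hq (q, 0) / Num.sqrt (1 + hq (q, 0) ^+ 2)).
  by apply/funext => q; rewrite /curvature_flux /l /= clamp0.
have ES' : {ae mu, forall q, - flux1 k l K (q, 0) + g * elevation h H q - sigma * S q = 0}.
  move: ES; apply: filterS; first exact: (ae_filter_ringOfSetsType mu).
  move=> q; rewrite /flux1 /k /l /K /= clamp0 /elevation => e.
  by rewrite -[RHS]e opprD opprK.
have l_tail e : 0 < e -> exists L0, forall q p,
    L0 <= `|q| -> - m <= p <= 0 -> `|l (q, p)| <= e.
  move=> e0; have [L0 L0P] := uniform_tail (hq_pinfty hwave) (hq_ninfty hwave) e0.
  exists L0 => q p Lq pm; rewrite /l /= clamp_id//.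
  by apply: L0P => //=; rewrite in_itv.
have KHp : \int[mu]_(p in `[- m, 0]) (K p ^+ 3) = \int[mu]_(p in `[- m, 0]) (Hp p ^+ 3).
  by apply: eq_Rintegral => p /set_mem; rewrite /= in_itv/= => pm; rewrite /K clamp_id.
rewrite -KHp in sgn.
have kK := height_derivatives_eq m0 (inf_hp_gt0 hwave) kc lc Kc kc0 K0 etaE _ _
  f1A f2B AB kS' ES' l_tail sgn.
have {}kK q p : - m < p < 0 -> hp (q, p) = Hp p.
  move=> pm; have := kK _ _ q p pm; rewrite /k /K /= clampE//; apply.
  - by move=> x xs; rewrite /flux1 /k /l /K stripE// clampE.
  - by move=> x xs; rewrite /flux2 /k /l stripE.
move=> [q p] pm; have /andP[mp p0] := pm.
have dhK x : x \in `]- m, p[%R -> is_derive x (1 : R) (hK q) 0.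
  rewrite in_itv/= => /andP[mx xp].
  have xm : - m < x < 0 by rewrite mx (lt_le_trans xp).
  by have := hK_derive q xm; rewrite kK// subrr.
have [c _] := MVT_segment mp dhK (continuous_subspaceT (@hK_c q)).
by rewrite mul0r hK_bottom subr0 /hK clamp_id// => /eqP; rewrite subr_eq0 => /eqP.
Qed.

End rigidity.

Unset Implicit Arguments.

Theorem theorem8p1 (R : realType) (g d m sigma alpha F : R)
    (h hq hp : R * R -> R) (H Hp : R -> R) :
  0 < g -> 0 < d -> 0 < m -> 0 < alpha < 1 ->
  wave_regularity m alpha h hq hp H Hp ->
  solitary_wave g d m sigma h hq hp H Hp ->
  is_froude_number g m Hp F ->
  (nontrivial_wave m h H -> F <> 1) /\
  (wave_of_elevation h H -> 1 < F) /\
  (wave_of_depression h H -> F < 1).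
Proof.
move=> g0 d0 m0 alpha01 hreg hwave [F0 FE].
have triv := wave_trivial m0 alpha01 hreg hwave; rewrite -FE in triv.
have flat q : (forall q, (1 - 1 / F ^+ 2) * elevation h H q <= 0) -> elevation h H q = 0.
  move=> sgn; rewrite /elevation (triv sgn (q, 0)) ?subrr//.
  by rewrite /closed_strip/= lexx oppr_le0 ltW.
split; [|split].
- move=> [x xs hx] F1; apply: hx; apply: triv => // q.
  by rewrite F1 expr1n divr1 subrr mul0r.
- move=> [eta0 [q etaq]]; rewrite ltNge; apply/negP => F1; apply/etaq/flat => q'.
  apply: mulr_le0_ge0 => //; rewrite subr_le0 ler_pdivlMr ?exprn_gt0// mul1r.
  by rewrite expr_le1// ltW.
- move=> [eta0 [q etaq]]; rewrite ltNge; apply/negP => F1; apply/etaq/flat => q'.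
  apply: mulr_ge0_le0 => //; rewrite subr_ge0 ler_pdivrMr ?exprn_gt0// mul1r.
  by rewrite expr_ge1// ltW.
Qed.
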